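(* Let $K$ be an arbitrary field of characteristic $0$ such that the equation $\lambda^2+\lambda+1=0$ has a solution $\epsilon$ in $K$, and let $\alpha\in K$. If $\alpha^3\neq1$, then $$\mathrm{Aut}\,E_\alpha=(\langle\varphi_\gamma\rangle\times\langle\tau\rangle)\rtimes\langle\sigma\rangle=(\langle\varphi_\gamma\rangle\times\langle\sigma\rangle)\rtimes\langle\tau\rangle\cong(K^*\times Z_3)\rtimes Z_3 .$$
   Context: For $\alpha\in K$ put $C=\frac13(x^3+y^3+z^3)-\alpha xyz\in K[x,y,z]$. The elliptic Poisson algebra $E_\alpha$ is the polynomial algebra $K[x,y,z]$ endowed with the Poisson bracket determined by $\{x,y\}=-\alpha xy+z^2$, $\{y,z\}=-\alpha yz+x^2$, $\{z,x\}=-\alpha zx+y^2$; equivalently $\{u,v\}=J(u,v,C)$ for all $u,v\in K[x,y,z]$, where $J(f_1,f_2,f_3)$ is the determinant of the Jacobian matrix of $(f_1,f_2,f_3)$ with respect to $(x,y,z)$. An automorphism of a Poisson algebra $P$ over $K$ is a bijective $K$-linear map $\phi:P\to P$ with $\phi(ab)=\phi(a)\phi(b)$ and $\phi(\{a,b\})=\{\phi(a),\phi(b)\}$ for all $a,b\in P$. $\mathrm{Aut}\,E_\alpha$ is the group of automorphisms of $E_\alpha$ as a Poisson algebra. $K^*$ is the multiplicative group of $K$ and $Z_3$ is the cyclic group of order $3$. The following are automorphisms of $E_\alpha$: $\varphi_\gamma$ ($\gamma\in K^*$), given by $x\mapsto\gamma x$, $y\mapsto\gamma y$, $z\mapsto\gamma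 z$; $\tau$, given by $x\mapsto y$, $y\mapsto z$, $z\mapsto x$; and $\sigma$, given by $x\mapsto x$, $y\mapsto\epsilon y$, $z\mapsto\epsilon^2 z$. Here $\langle\varphi_\gamma\rangle=\{\varphi_\gamma\mid\gamma\in K^*\}\cong K^*$, while $\langle\tau\rangle$ and $\langle\sigma\rangle$ are the subgroups generated by $\tau$ and $\sigma$, each isomorphic to $Z_3$. The products $\times$ and $\rtimes$ in the two equalities are internal direct and semidirect products of subgroups of $\mathrm{Aut}\,E_\alpha$, the normal subgroup in the semidirect product $N\rtimes H$ being $N$. *)

(* Defs.v *)
From HB Require Import structures.
From mathcomp Require Import all_boot all_order all_algebra all_fingroup.
From mathcomp Require Import boolp classical_sets.
From mathcomp Require Import mpoly.
From mathcomp Require Import ring.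

Set Implicit Arguments.
Unset Strict Implicit.
Unset Printing Implicit Defensive.

Import GRing.Theory.
Local Open Scope classical_set_scope.
Local Open Scope ring_scope.

Section InternalProducts.
Variable G : groupType.
Local Open Scope group_scope.
Implicit Types A B M N H : set G.

Definition subgroup_set H : Prop :=
  H 1 /\ forall x y, H x -> H y -> H (x * y^-1).

Definition gen_subgroup A : set G := smallest subgroup_set A.

Definition mulset A B : set G := [set x * y | x in A & y in B].

Definition internal_dprod A B M : Prop :=
  [/\ subgroup_set A, subgroup_set B, forall a b, A a -> B b -> commute a b,
      A `&` B = [set 1] & mulset A B = M].

(* [N] is the normal factor: [M] = [N] ><| [H]. *)
Definition internal_sdprod N H M : Prop :=
  [/\ subgroup_set N, subgroup_set H, forall n m, N n -> M m -> N (n ^ m),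
      N `&` H = [set 1] & mulset N H = M].

End InternalProducts.

Definition group_isomorphic (G H : groupType) : Prop :=
  exists f : {multiplicative G -> H}, bijective f.

(* Homomorphisms from [H] to the automorphism group of [N]; bijectivity of
   [gact h] follows from [gact1] and [gactM]. *)
Record group_act (N H : groupType) := GroupAct {
  gact :> H -> N -> N;
  gact_morph : forall h, {morph gact h : x y / (x * y)%g};
  gact1 : forall n, gact 1%g n = n;
  gactM : forall h k n, gact (h * k)%g n = gact h (gact k n) }.

Definition external_sdprod (N H : groupType) (act : group_act N H) : Type :=
  (N * H)%type.

Section ExternalSdprod.
Variables (N H : groupType) (act : group_act N H).
Local Open Scope group_scope.
Local Notation sdT := (external_sdprod act).

HB.instance Definition _ := Choice.copy sdT (N * H)%type.

Definition sd_mul (u v : sdT) : sdT := (u.1 * act u.2 v.1, u.2 * v.2).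
Definition sd_one : sdT := (1, 1).
Definition sd_inv (u : sdT) : sdT := (act u.2^-1 u.1^-1, u.2^-1).

Lemma gact_id1 h : act h 1 = 1.
Proof. by apply: (mulgI (act h 1)); rewrite -gact_morph !mulg1. Qed.

Lemma sd_mulA : associative sd_mul.
Proof.
by move=> [a b] [c d] [e f]; rewrite /sd_mul /= gact_morph gactM !mulgA.
Qed.

Lemma sd_mul1g : left_id sd_one sd_mul.
Proof. by move=> [a b]; rewrite /sd_mul /= gact1 !mul1g. Qed.

Lemma sd_mulg1 : right_id sd_one sd_mul.
Proof. by move=> [a b]; rewrite /sd_mul /= gact_id1 !mulg1. Qed.

Lemma sd_mulVg : left_inverse sd_one sd_inv sd_mul.
Proof.
by move=> [a b]; rewrite /sd_mul /= -gact_morph !mulVg gact_id1.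
Qed.

Lemma sd_mulgV : right_inverse sd_one sd_inv sd_mul.
Proof. by move=> [a b]; rewrite /sd_mul /= -gactM !mulgV gact1 mulgV. Qed.

HB.instance Definition _ :=
  isGroup.Build sdT sd_mulA sd_mul1g sd_mulg1 sd_mulVg sd_mulgV.

End ExternalSdprod.

Definition kstar (K : fieldType) : Type := {x : K | x != 0}.

Section Kstar.
Variable K : fieldType.

HB.instance Definition _ := Choice.copy (kstar K) {x : K | x != 0}.

Definition kstar_one : kstar K := exist _ 1 (oner_neq0 K).
Definition kstar_mul (u v : kstar K) : kstar K :=
  exist _ (val u * val v) (mulf_neq0 (valP u) (valP v)).
Lemma kstar_inv_subproof (u : kstar K) : (val u)^-1 != 0.
Proof. by rewrite invr_eq0 (valP u). Qed.
Definition kstar_inv (u : kstar K) : kstar K :=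
  exist _ (val u)^-1 (kstar_inv_subproof u).

Lemma kstar_mulA : associative kstar_mul.
Proof. by move=> u v w; apply/val_inj/mulrA. Qed.
Lemma kstar_mul1g : left_id kstar_one kstar_mul.
Proof. by move=> u; apply/val_inj/mul1r. Qed.
Lemma kstar_mulg1 : right_id kstar_one kstar_mul.
Proof. by move=> u; apply/val_inj/mulr1. Qed.
Lemma kstar_mulVg : left_inverse kstar_one kstar_inv kstar_mul.
Proof. by move=> u; apply/val_inj/mulVf/(valP u). Qed.
Lemma kstar_mulgV : right_inverse kstar_one kstar_inv kstar_mul.
Proof. by move=> u; apply/val_inj/mulfV/(valP u). Qed.

HB.instance Definition _ := isGroup.Build (kstar K)
  kstar_mulA kstar_mul1g kstar_mulg1 kstar_mulVg kstar_mulgV.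

End Kstar.

Section PoissonAut.
Variables (K : fieldType) (A : comAlgType K) (br : A -> A -> A).

Definition poisson_bracket : Prop :=
  [/\ forall (k : K) a b c, br (k *: a + b) c = k *: br a c + br b c,
      forall a, br a a = 0,
      forall a b, br b a = - br a b,
      forall a b c, br a (br b c) + br b (br c a) + br c (br a b) = 0 &
      forall a b c, br (a * b) c = a * br b c + b * br a c].

Definition poisson_automorphism (f : A -> A) : Prop :=
  [/\ bijective f, linear f, {morph f : a b / a * b}
    & {morph f : a b / br a b}].

Record poisson_aut := PoissonAut {
  paut_fun :> A -> A;
  pautP : poisson_automorphism paut_fun }.

Lemma paut_ext (f g : poisson_aut) : paut_fun f =1 paut_fun g -> f = g.
Proof.
case: f g => [f Pf] [g Pg] /= /funext eqfg.
by case: _ / eqfg Pg => Pg; congr PoissonAut; apply: Prop_irrelevance.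
Qed.

HB.instance Definition _ := gen_eqMixin poisson_aut.
HB.instance Definition _ := gen_choiceMixin poisson_aut.

Lemma paut_one_subproof : poisson_automorphism id.
Proof. by split=> //; exists id. Qed.
Definition paut_one := PoissonAut paut_one_subproof.

Lemma paut_mul_subproof (f g : poisson_aut) : poisson_automorphism (paut_fun f \o paut_fun g).
Proof.
case: f g => [f [bf lf mf hf]] [g [bg lg mg hg]] /=; split.
- exact: bij_comp.
- by move=> k a b /=; rewrite lg lf.
- by move=> a b /=; rewrite mg mf.
- by move=> a b /=; rewrite hg hf.
Qed.
Definition paut_mul f g := PoissonAut (paut_mul_subproof f g).

Lemma paut_inv_subproof (f : poisson_aut) :
  exists g : poisson_aut,
    cancel (paut_fun f) (paut_fun g) /\ cancel (paut_fun g) (paut_fun f).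
Proof.
case: f => [f [[g fK gK] lf mf hf]] /=.
have Pg : poisson_automorphism g.
  split; first by exists f.
  - by move=> k a b; apply: (can_inj fK); rewrite lf !gK.
  - by move=> a b; apply: (can_inj fK); rewrite mf !gK.
  - by move=> a b; apply: (can_inj fK); rewrite hf !gK.
by exists (PoissonAut Pg).
Qed.
Definition paut_inv f := projT1 (cid (paut_inv_subproof f)).

Lemma paut_invK f : cancel (paut_fun f) (paut_fun (paut_inv f)) /\ cancel (paut_fun (paut_inv f)) (paut_fun f).
Proof. exact: projT2 (cid (paut_inv_subproof f)). Qed.

Lemma paut_mulA : associative paut_mul.
Proof. by move=> f g h; apply: paut_ext. Qed.
Lemma paut_mul1g : left_id paut_one paut_mul.
Proof. by move=> f; apply: paut_ext. Qed.
Lemma paut_mulg1 : right_id paut_one paut_mul.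
Proof. by move=> f; apply: paut_ext. Qed.
Lemma paut_mulVg : left_inverse paut_one paut_inv paut_mul.
Proof. by move=> f; apply: paut_ext => a /=; rewrite (paut_invK f).1. Qed.
Lemma paut_mulgV : right_inverse paut_one paut_inv paut_mul.
Proof. by move=> f; apply: paut_ext => a /=; rewrite (paut_invK f).2. Qed.

(* The product is composition: (f * g)%g a = f (g a). *)
HB.instance Definition _ := isGroup.Build poisson_aut
  paut_mulA paut_mul1g paut_mulg1 paut_mulVg paut_mulgV.

End PoissonAut.

Lemma det3 (R : comNzRingType) (M : 'M[R]_3) : \det M =
  M 0 0 * (M 1 1 * M 2 2 - M 1 2 * M 2 1)
  - M 0 1 * (M 1 0 * M 2 2 - M 1 2 * M 2 0)
  + M 0 2 * (M 1 0 * M 2 1 - M 1 1 * M 2 0).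
Proof.
pose F (i j : nat) := M (inord i) (inord j).
have E i j : M i j = F i j by rewrite /F !inord_val.
rewrite (expand_det_row _ 0) !big_ord_recl big_ord0 /cofactor.
rewrite !(expand_det_row _ 0) !big_ord_recl !big_ord0 /cofactor !det_mx11 !mxE.
rewrite !E /= /bump /= !addn0 !add1n !add0n.
move: (F 0 0) (F 0 1) (F 0 2) (F 1 0) (F 1 1) (F 1 2) (F 2 0) (F 2 1) (F 2 2).
by move=> *; ring.
Qed.

Section Biderivation.
Variable K : fieldType.
Local Notation P := {mpoly K[3]}.
Implicit Types u v w : P.

Lemma mpoly_alg_ind (Q : P -> Prop) :
  Q 1 -> (forall i, Q 'X_i) -> (forall k u v, Q u -> Q v -> Q (k *: u + v)) ->
  (forall u v, Q u -> Q v -> Q (u * v)) -> forall u, Q u.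
Proof.
move=> Q1 QX QL QM; have Q0 : Q 0.
  by rewrite -(addNr 1) -scaleN1r; apply: QL.
elim/mpolyind => // c m p _ _ Qp; apply: QL => //.
rewrite mpolyXE_id; apply: big_ind => // i _.
by elim: (m i) => [|k IH]; rewrite ?expr0 // exprS; apply: QM.
Qed.

Lemma ord3 (i : 'I_3) : [\/ i = 0, i = 1 | i = 2].
Proof.
case: i => [[|[|[|//]]] lt_i3].
- by constructor 1; apply: val_inj.
- by constructor 2; apply: val_inj.
- by constructor 3; apply: val_inj.
Qed.

Variable br : P -> P -> P.
Hypothesis brL : forall k u v w, br (k *: u + v) w = k *: br u w + br v w.
Hypothesis br_diag : forall u, br u u = 0.
Hypothesis br_anti : forall u v, br v u = - br u v.
Hypothesis brM : forall u v w, br (u * v) w = u * br v w + v * br u w.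

Lemma bider1 w : br 1 w = 0.
Proof.
have := brM 1 1 w; rewrite !mul1r => /eqP.
by rewrite -subr_eq0 opprD addrA subrr sub0r oppr_eq0 => /eqP.
Qed.

Lemma biderD u v w : br (u + v) w = br u w + br v w.
Proof. by have := brL 1 u v w; rewrite !scale1r. Qed.

Lemma bider0 w : br 0 w = 0.
Proof.
have /eqP := biderD 0 0 w.
by rewrite addr0 -subr_eq0 opprD addrA subrr sub0r oppr_eq0 => /eqP.
Qed.

Lemma biderZ k u w : br (k *: u) w = k *: br u w.
Proof. by have := brL k u 0 w; rewrite bider0 !addr0. Qed.

Lemma biderDr u v w : br w (u + v) = br w u + br w v.
Proof. by rewrite br_anti biderD opprD -!(br_anti _ w). Qed.

Lemma biderZr k u w : br w (k *: u) = k *: br w u.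
Proof. by rewrite br_anti biderZ -scalerN -(br_anti _ w). Qed.

Lemma biderNr u w : br w (- u) = - br w u.
Proof. by rewrite -scaleN1r biderZr scaleN1r. Qed.

Lemma bider0r w : br w 0 = 0.
Proof. by rewrite br_anti bider0 oppr0. Qed.

Lemma biderMr u v w : br w (u * v) = u * br w v + v * br w u.
Proof. by rewrite br_anti brM opprD -!mulrN -!(br_anti _ w). Qed.

Local Notation J u v w := (br u (br v w) + br v (br w u) + br w (br u v)).

Lemma bider_jacobi : J 'X_0 'X_1 'X_2 = 0 -> forall u v w, J u v w = 0.
Proof.
move=> Jxyz.
have Jrot u v w : J u v w = J v w u by rewrite -addrA addrC.
have JL k u u' v w : J (k *: u + u') v w = k *: J u v w + J u' v w.
  rewrite !(brL, biderDr, biderZr) !scalerDr !addrA.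
  by rewrite -!mul_mpolyC; ring.
have JM u u' v w : J (u * u') v w = u * J u' v w + u' * J u v w.
  rewrite !(brM, biderMr, biderDr) (br_anti u v) (br_anti u' v).
  by ring.
have Jind v w : (forall i, J 'X_i v w = 0) -> forall u, J u v w = 0.
  move=> H; elim/mpoly_alg_ind => [|//|k u u' Eu Eu'|u u' Eu Eu'].
  - by rewrite !(br_anti 1) !bider1 !oppr0 !bider0r !addr0.
  - by rewrite JL Eu Eu' scaler0 addr0.
  - by rewrite JM Eu Eu' !mulr0 addr0.
have Jdiag u w : J u u w = 0.
  by rewrite br_diag bider0r addr0 (br_anti u w) biderNr subrr.
have Jswap u v w : J u v w = - J v u w.
  by rewrite (br_anti v w) (br_anti w u) (br_anti u v) !biderNr; ring.
suff Jgen i j k : J 'X_i 'X_j 'X_k = 0.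
  move=> u v w; apply: (Jind) => i.
  rewrite Jrot; apply: (Jind) => j; rewrite Jrot; apply: (Jind) => k.
  by rewrite Jrot.
have Jyxz : J 'X_1 'X_0 'X_2 = 0 by rewrite Jswap Jxyz oppr0.
by case: (ord3 i) => ->; case: (ord3 j) => ->; case: (ord3 k) => ->;
  do ?[exact: Jdiag | exact: Jxyz | exact: Jyxz | rewrite Jrot].
Qed.

Lemma bider_subst (t : 3.-tuple P) :
  br 'X_0 'X_1 \mPo t = br t`_0 t`_1 ->
  br 'X_1 'X_2 \mPo t = br t`_1 t`_2 ->
  br 'X_2 'X_0 \mPo t = br t`_2 t`_0 ->
  forall u v, br u v \mPo t = br (u \mPo t) (v \mPo t).
Proof.
move=> hxy hyz hzx.
have ind w : (forall i, br 'X_i w \mPo t = br ('X_i \mPo t) (w \mPo t)) ->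
    forall u, br u w \mPo t = br (u \mPo t) (w \mPo t).
  move=> Hw; elim/mpoly_alg_ind => [|//|k u v Eu Ev|u v Eu Ev].
  - by rewrite comp_mpoly1 !bider1 comp_mpoly0.
  - by rewrite brL !comp_mpolyD !comp_mpolyZ brL Eu Ev.
  - by rewrite brM rmorphD !rmorphM /= brM Eu Ev.
have anti u v : br u v \mPo t = br (u \mPo t) (v \mPo t) ->
    br v u \mPo t = br (v \mPo t) (u \mPo t).
  by move=> E; rewrite br_anti comp_mpolyN E -br_anti.
suff gen i j : br 'X_i 'X_j \mPo t = br ('X_i \mPo t) ('X_j \mPo t).
  by move=> u v; apply: (ind) => i; apply: anti; apply: (ind) => j.
rewrite !comp_mpolyXU.
case: (ord3 i) => ->; case: (ord3 j) => -> //; rewrite ?br_diag ?comp_mpoly0 //.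
- by rewrite br_anti comp_mpolyN hzx -br_anti.
- by rewrite br_anti comp_mpolyN hxy -br_anti.
- by rewrite br_anti comp_mpolyN hyz -br_anti.
Qed.

End Biderivation.

Section Elliptic.
Variables (K : fieldType) (alpha : K).
Local Notation P := {mpoly K[3]}.
Implicit Types u v w : P.

Local Notation x := ('X_0 : P).
Local Notation y := ('X_1 : P).
Local Notation z := ('X_2 : P).

Definition jacobian (f g h : P) : P :=
  \det (\matrix_(i < 3, j < 3) ([:: f; g; h]`_i)^`M(j)).

Definition elliptic_C : P :=
  (3%:R^-1 : K) *: (x ^+ 3 + y ^+ 3 + z ^+ 3) - alpha *: (x * y * z).

Definition elliptic_br u v : P := jacobian u v elliptic_C.

Lemma jacobianE f g h : jacobian f g h =
  f^`M(0) * (g^`M(1) * h^`M(2) - g^`M(2) * h^`M(1))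
  - f^`M(1) * (g^`M(0) * h^`M(2) - g^`M(2) * h^`M(0))
  + f^`M(2) * (g^`M(0) * h^`M(1) - g^`M(1) * h^`M(0)).
Proof. by rewrite /jacobian det3 !mxE. Qed.

Lemma elliptic_brL k u v w :
  elliptic_br (k *: u + v) w = k *: elliptic_br u w + elliptic_br v w.
Proof.
rewrite /elliptic_br; move: elliptic_C => C.
by rewrite !jacobianE !mderivD !mderivZ -!mul_mpolyC; ring.
Qed.

Lemma elliptic_br_diag u : elliptic_br u u = 0.
Proof. by rewrite /elliptic_br; move: elliptic_C => C; rewrite !jacobianE; ring. Qed.

Lemma elliptic_br_antisym u v : elliptic_br v u = - elliptic_br u v.
Proof. by rewrite /elliptic_br; move: elliptic_C => C; rewrite !jacobianE; ring. Qed.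

Lemma elliptic_brM u v w :
  elliptic_br (u * v) w = u * elliptic_br v w + v * elliptic_br u w.
Proof.
rewrite /elliptic_br; move: elliptic_C => C.
by rewrite !jacobianE !mderivM; ring.
Qed.

Lemma elliptic_brZ k u v : elliptic_br (k *: u) v = k *: elliptic_br u v.
Proof. exact: biderZ elliptic_brL k u v. Qed.

Lemma elliptic_brZr k u v : elliptic_br u (k *: v) = k *: elliptic_br u v.
Proof. exact: biderZr elliptic_brL elliptic_br_antisym k v u. Qed.

Lemma mderivU (i j : 'I_3) : ('X_j : P)^`M(i) = (i == j)%:R.
Proof.
rewrite mderivX mnm1E eq_sym; case: eqP => [->|_]; last by rewrite scale0r.
suff -> : (U_(j) - U_(j))%MM = 0%MM by rewrite scale1r mpolyX0.
by apply/mnmP => k; rewrite mnmBE mnm0E subnn.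
Qed.

(* Equal to 1 except in characteristic 3. *)
Local Notation c3 := (3%:R^-1 * 3%:R : K).

Lemma elliptic_C_deriv :
  [/\ elliptic_C^`M(0) = c3 *: x ^+ 2 - alpha *: (y * z),
      elliptic_C^`M(1) = c3 *: y ^+ 2 - alpha *: (z * x) &
      elliptic_C^`M(2) = c3 *: z ^+ 2 - alpha *: (x * y)].
Proof.
split; rewrite /elliptic_C !exprS !expr0 !mulr1
  !(mderivD, mderivN, mderivM, mderivZ, mderivU) /= -!mul_mpolyC mpolyCM
  mpolyC_nat; ring.
Qed.

Lemma elliptic_br_gen :
  [/\ elliptic_br x y = - (alpha *: (x * y)) + c3 *: z ^+ 2,
      elliptic_br y z = - (alpha *: (y * z)) + c3 *: x ^+ 2 &
      elliptic_br z x = - (alpha *: (z * x)) + c3 *: y ^+ 2].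
Proof.
have [CX CY CZ] := elliptic_C_deriv; rewrite /elliptic_br.
move: elliptic_C CX CY CZ => C CX CY CZ.
split; rewrite jacobianE CX CY CZ !mderivU /=
  !(mul1r, mul0r, mulr0, subr0, sub0r, addr0, add0r, oppr0) ?opprK addrC //.
Qed.

Lemma elliptic_br_pchar0 : [pchar K] =i pred0 ->
  [/\ elliptic_br x y = - (alpha *: (x * y)) + z ^+ 2,
      elliptic_br y z = - (alpha *: (y * z)) + x ^+ 2 &
      elliptic_br z x = - (alpha *: (z * x)) + y ^+ 2].
Proof.
move=> K0; have [-> -> ->] := elliptic_br_gen.
by rewrite mulVf ?scale1r // (pcharf0P K).1.
Qed.

Lemma elliptic_br_poisson : poisson_bracket elliptic_br.
Proof.
have [exy eyz ezx] := elliptic_br_gen.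
split; [exact: elliptic_brL | exact: elliptic_br_diag
  | exact: elliptic_br_antisym | | exact: elliptic_brM].
move: elliptic_br elliptic_brL elliptic_br_diag elliptic_br_antisym elliptic_brM
  exy eyz ezx => br brL br0 brA brM exy eyz ezx.
apply: bider_jacobi => //.
have br2 u : br u (u ^+ 2) = 0.
  by rewrite expr2 (biderMr brA brM) br0 mulr0 addr0.
rewrite exy eyz ezx !(biderDr brL brA) !(biderNr brL brA) !(biderZr brL brA).
rewrite !br2 !(biderMr brA brM) (brA x y) (brA y z) (brA z x).
by rewrite -!mul_mpolyC; ring.
Qed.

Lemma subst_poisson_automorphism (t t' : 3.-tuple P) :
  (forall i, t'`_(i : 'I_3) \mPo t = 'X_i) ->
  (forall i, t`_(i : 'I_3) \mPo t' = 'X_i) ->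
  elliptic_br x y \mPo t = elliptic_br t`_0 t`_1 ->
  elliptic_br y z \mPo t = elliptic_br t`_1 t`_2 ->
  elliptic_br z x \mPo t = elliptic_br t`_2 t`_0 ->
  poisson_automorphism elliptic_br (comp_mpoly t).
Proof.
move=> tK tK' hxy hyz hzx.
have subK (s s' : 3.-tuple P) : (forall i, s'`_(i : 'I_3) \mPo s = 'X_i :> P) ->
    cancel (comp_mpoly s') (comp_mpoly s).
  move=> sK; elim/mpoly_alg_ind => [|i|k u v Eu Ev|u v Eu Ev].
  - by rewrite !rmorph1.
  - by rewrite comp_mpolyXU sK.
  - by rewrite !linearP /= Eu Ev.
  - by rewrite !rmorphM /= Eu Ev.
split; first by exists (comp_mpoly t'); apply: subK.
- by move=> k u v; rewrite linearP.
- by move=> u v; rewrite rmorphM.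
- apply: bider_subst hxy hyz hzx.
  + exact: elliptic_brL.
  + exact: elliptic_br_diag.
  + exact: elliptic_br_antisym.
  + exact: elliptic_brM.
Qed.

Definition phi_tuple (gamma : K) : 3.-tuple P :=
  [tuple gamma *: x; gamma *: y; gamma *: z].

Lemma phi_subproof (gamma : kstar K) :
  poisson_automorphism elliptic_br (comp_mpoly (phi_tuple (val gamma))).
Proof.
have g0 := valP gamma; move: (val gamma) g0 => {gamma} /= g g0.
have [exy eyz ezx] := elliptic_br_gen; have brZ := elliptic_brZ.
have brZZ k l u v : elliptic_br (k *: u) (l *: v) = (k * l) *: elliptic_br u v.
  by rewrite brZ elliptic_br_antisym brZ -scalerN -elliptic_br_antisym scalerA.
apply: (@subst_poisson_automorphism _ (phi_tuple g^-1)) => [i|i| | |].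
- by case: (ord3 i) => ->; rewrite comp_mpolyZ comp_mpolyXU scalerA mulVf // scale1r.
- by case: (ord3 i) => ->; rewrite comp_mpolyZ comp_mpolyXU scalerA mulfV // scale1r.
- rewrite /= brZZ exy rmorphD rmorphN /= !comp_mpolyZ !rmorphXn rmorphM /=
    !comp_mpolyXU /= -!mul_mpolyC !mpolyCM; ring.
- rewrite /= brZZ eyz rmorphD rmorphN /= !comp_mpolyZ !rmorphXn rmorphM /=
    !comp_mpolyXU /= -!mul_mpolyC !mpolyCM; ring.
- rewrite /= brZZ ezx rmorphD rmorphN /= !comp_mpolyZ !rmorphXn rmorphM /=
    !comp_mpolyXU /= -!mul_mpolyC !mpolyCM; ring.
Qed.

Definition phi (gamma : kstar K) : poisson_aut elliptic_br :=
  PoissonAut (phi_subproof gamma).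

Definition tau_tuple : 3.-tuple P := [tuple y; z; x].

Lemma tau_subproof : poisson_automorphism elliptic_br (comp_mpoly tau_tuple).
Proof.
have [exy eyz ezx] := elliptic_br_gen.
apply: (@subst_poisson_automorphism _ [tuple z; x; y]) => [i|i| | |].
- by case: (ord3 i) => ->; rewrite comp_mpolyXU.
- by case: (ord3 i) => ->; rewrite comp_mpolyXU.
- by rewrite /= eyz exy rmorphD rmorphN /= !comp_mpolyZ rmorphXn rmorphM /=
    !comp_mpolyXU.
- by rewrite /= eyz ezx rmorphD rmorphN /= !comp_mpolyZ rmorphXn rmorphM /=
    !comp_mpolyXU.
- by rewrite /= ezx exy rmorphD rmorphN /= !comp_mpolyZ rmorphXn rmorphM /=
    !comp_mpolyXU.
Qed.

Definition tau : poisson_aut elliptic_br := PoissonAut tau_subproof.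

Section Eps.
Variables (eps : K) (eps_root : eps ^+ 2 + eps + 1 = 0).

Lemma eps_cube : eps ^+ 3 = 1.
Proof.
apply/eqP; rewrite -subr_eq0; apply/eqP.
have -> : eps ^+ 3 - 1 = (eps - 1) * (eps ^+ 2 + eps + 1) by ring.
by rewrite eps_root mulr0.
Qed.

Definition sigma_tuple : 3.-tuple P := [tuple x; eps *: y; eps ^+ 2 *: z].

Lemma sigma_subproof :
  poisson_automorphism elliptic_br (comp_mpoly sigma_tuple).
Proof.
have [exy eyz ezx] := elliptic_br_gen; have brZ := elliptic_brZ.
have brZr k u v : elliptic_br u (k *: v) = k *: elliptic_br u v.
  by rewrite elliptic_br_antisym brZ -scalerN -elliptic_br_antisym.
have e3 := eps_cube.
have e3' : eps * eps ^+ 2 = 1 by rewrite -exprS.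
have e3'' : eps ^+ 2 * eps = 1 by rewrite -exprSr.
have e4 : (eps ^+ 2) ^+ 2 = eps by rewrite -exprM (exprD _ 3 1) e3 mul1r.
apply: (@subst_poisson_automorphism _ [tuple x; eps ^+ 2 *: y; eps *: z])
  => [i|i| | |].
- by case: (ord3 i) => ->;
    rewrite /= ?comp_mpolyZ comp_mpolyXU ?scalerA ?e3' ?e3'' ?scale1r.
- by case: (ord3 i) => ->;
    rewrite /= ?comp_mpolyZ comp_mpolyXU ?scalerA ?e3' ?e3'' ?scale1r.
- rewrite /= brZr exy rmorphD rmorphN /= !comp_mpolyZ !rmorphXn rmorphM /=
    !comp_mpolyXU /= exprZn e4 -!mul_mpolyC; ring.
- rewrite /= brZr brZ scalerA e3'' scale1r eyz rmorphD rmorphN /= !comp_mpolyZ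
    !rmorphXn rmorphM /= !comp_mpolyXU /= -scalerAl -scalerAr !scalerA -!mulrA.
  by rewrite e3' mulr1.
- rewrite /= brZ ezx rmorphD rmorphN /= !comp_mpolyZ !rmorphXn rmorphM /=
    !comp_mpolyXU /= exprZn -!mul_mpolyC; ring.
Qed.

Definition sigma : poisson_aut elliptic_br := PoissonAut sigma_subproof.

End Eps.
End Elliptic.

Section ModelGroup.
Variables (K : fieldType) (eps : K) (eps_root : eps ^+ 2 + eps + 1 = 0).

Lemma eps_neq0 : eps != 0.
Proof.
by apply/eqP => e0; move/eqP: (eps_cube eps_root); rewrite e0 expr0n eq_sym oner_eq0.
Qed.

Definition eps_kstar : kstar K := exist _ eps eps_neq0.

Lemma eps_kstarX n : (eps_kstar ^+ (n %% 3) = eps_kstar ^+ n)%g.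
Proof.
have e3 : (eps_kstar ^+ 3 = 1)%g.
  by apply: val_inj; rewrite -[RHS]/(1 : K) -(eps_cube eps_root).
by rewrite {2}(divn_eq n 3) expgnDr mulnC expgnA e3 expg1n mul1g.
Qed.

Definition twist (j : 'Z_3) (u : kstar K * 'Z_3) : kstar K * 'Z_3 :=
  ((eps_kstar ^+ (u.2 * j)%N * u.1)%g, u.2).

Lemma kstar_mulC (u v : kstar K) : (u * v = v * u)%g.
Proof. by apply/val_inj/mulrC. Qed.

Lemma twist_morph j : {morph twist j : u v / (u * v)%g}.
Proof.
move=> [g i] [h k]; rewrite /twist; congr pair => /=.
rewrite -eps_kstarX modnMml eps_kstarX mulnDl expgnDr -!mulgA; congr (_ * _)%g.
by rewrite !mulgA; congr (_ * _)%g; apply: kstar_mulC.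
Qed.

Lemma twist1 u : twist 1%g u = u.
Proof. by case: u => g i; rewrite /twist /= muln0 expg0 mul1g. Qed.

Lemma twistM j k u : twist (j * k)%g u = twist j (twist k u).
Proof.
case: u => g i; rewrite /twist; congr pair => /=.
by rewrite -eps_kstarX modnMmr eps_kstarX mulnDr expgnDr mulgA.
Qed.

(* The additive group 'Z_3 acts on K^* x 'Z_3 by
   j . (gamma, i) = (eps ^+ (i * j) * gamma, i), as dictated by
   sigma ^+ j * (phi gamma * tau ^+ i) * sigma ^- j
   = phi (eps ^+ (i * j) * gamma) * tau ^+ i. *)
Definition twist_act : group_act (kstar K * 'Z_3)%type 'Z_3 :=
  GroupAct twist_morph twist1 twistM.

End ModelGroup.

(* Main.v *)
Require Import Defs.
From HB Require Import structures.
From mathcomp Require Import all_boot all_order all_algebra.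
From mathcomp Require Import boolp classical_sets.
From mathcomp Require Import mpoly.
From mathcomp Require Import ring.

Set Implicit Arguments.
Unset Strict Implicit.
Unset Printing Implicit Defensive.

Import GRing.Theory.
Local Open Scope classical_set_scope.
Local Open Scope ring_scope.

(** Let C be the cubic elliptic_C alpha and let f, g, h be the images of x, y, z
    under a Poisson automorphism.  Then f, g, h satisfy the defining relations
    {f, g} = h^2 - alpha f g and its cyclic rotations: they form an
    elliptic_triple.  The right-hand sides are the partial derivatives of C at
    (f, g, h), and alpha^3 <> 1 says exactly that these have no common zero but
    the origin (cubic_singular_eq0), i.e. that C = 0 is a smooth plane cubic.

    Degree one.  The chain rule turns the relations of a triple into
    grad C(f, g, h) = J(f, g, h) grad C (grad_C_triple).  For an automorphism
    J(f, g, h) is a unit, hence a constant j, and so C(f, g, h) = j C + b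
    (C_triple).  Suppose that the largest degree m among f, g, h is at least 2.
    The components of degree m again form an elliptic triple, because the
    bracket is homogeneous; comparing the parts of degree 3 m > 3 in
    C(f, g, h) = j C + b shows that this triple lies on the cone C = 0.  Now a
    curve of genus one has no rational parametrization: polynomials that satisfy
    C(f, g, h) = 0 have constant ratios (cubic_cone_wronskian).  So the
    brackets of the triple vanish, and it lies on the singular locus of C, which
    is the origin (triple_on_cone).  This contradicts the choice of m.

    Monomial form.  Hence f, g, h are linear forms, and b = 0.  The Hessian
    determinant is a covariant of C: since C is multiplied by j, the determinant
    of the substitution, so is its Hessian.  When alpha^3 <> 1 the product x y z
    is a linear combination of C and its Hessian (det_hessian_C), whence
    f g h = j x y z (triple_prod).  By unique factorization f, g, h are scalar
    multiples of x, y, z in some order.  The bracket relations exclude the odd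
    orders and make the scalars p, p w, p w^2 with w^3 = 1 (triple_monomial,
    paut_normal_form).  No value of alpha is special here: the projective
    symmetries of the cubic other than its translations multiply the invariant
    differential by a root of unity different from 1, whereas preserving the
    bracket means fixing it.

    Group structure.  So every automorphism is phi_gamma tau^i sigma^j, and
    gamma, i, j are read off from its values on x, y, z.  The commutation rule
    between sigma and tau makes (gamma, i, j) |-> phi_gamma tau^i sigma^j an
    isomorphism from the model group (aut_of_iso); the projections to i and to j
    are homomorphisms, and their kernels are the normal factors of the two
    semidirect products. *)

(** * Polynomial curves on a smooth plane cubic *)

(** Smoothness of the cubic in ideal form: modulo its partial derivatives
    x^2 = a y z, so x^4 = a^2 y^2 z^2 = a^4 x^2 y z = a^3 x^4, and a power of
    x lies in the ideal that they generate as soon as 1 - a^3 is invertible. *)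
Lemma cubic_grad_exp4 (R : comNzRingType) (a x y z : R) :
  (1 - a ^+ 3) * x ^+ 4 =
    ((1 - a ^+ 3) * x ^+ 2 + a * (y * z)) * (x ^+ 2 - a * (y * z))
    + (a ^+ 2 * z ^+ 2) * (y ^+ 2 - a * (z * x))
    + (a ^+ 3 * (z * x)) * (z ^+ 2 - a * (x * y)).
Proof. ring. Qed.

Lemma cubic_singular_eq0 (R : idomainType) (a x y z : R) : a ^+ 3 != 1 ->
  x ^+ 2 = a * (y * z) -> y ^+ 2 = a * (z * x) -> z ^+ 2 = a * (x * y) -> x = 0.
Proof.
move=> a3 ex ey ez; have := cubic_grad_exp4 a x y z.
rewrite -ex -ey -ez !subrr !mulr0 !addr0 => /eqP.
by rewrite mulf_eq0 subr_eq0 eq_sym (negPf a3) expf_eq0 /= => /eqP.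
Qed.

Lemma coefM_top (R : comNzRingType) (p q : {poly R}) m n :
  (size p <= m.+1)%N -> (size q <= n.+1)%N -> (p * q)`_(m + n) = p`_m * q`_n.
Proof.
move=> sp sq; have lt_m : (m < (m + n).+1)%N by rewrite ltnS leq_addr.
rewrite coefM (bigD1 (Ordinal lt_m)) //= addKn big1 ?addr0 // => i /eqP neq_im.
have [lt_im|] := ltnP i m.
  rewrite [q`__]nth_default ?mulr0 // (leq_trans sq) //.
  by rewrite ltn_subRL ltn_add2r.
rewrite leq_eqVlt => /predU1P[eq_mi|lt_mi].
  by case: neq_im; apply: val_inj.
by rewrite nth_default ?mul0r // (leq_trans sp).
Qed.

Section PlaneCubic.
Variables (L : fieldType) (a : L).
Hypotheses (L3 : 3%:R != 0 :> L) (a3 : a ^+ 3 != 1).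
Implicit Types d f g h p q : {poly L}.

Lemma Bezoutp_eq p q : exists u v, u * p + v * q = gcdp p q.
Proof.
have [[u v]] := Bezoutp p q => /eqpP[[c d] /= /andP[c0 d0] e].
exists ((c / d) *: u), ((c / d) *: v); apply: (scalerI d0).
by rewrite -e -!scalerAl -scalerDr scalerA mulrCA mulfV // mulr1.
Qed.

Lemma dvdp_exprD d p q m n :
  d %| p ^+ m -> d %| q ^+ n -> d %| (p + q) ^+ (m + n).
Proof.
move=> dp dq; rewrite exprDn.
apply: (big_ind (fun u => d %| u)) => [|u v|i _];
  [exact: dvdp0 | exact: dvdp_add | rewrite -mulr_natr].
apply: dvdp_mulr; have [lein|ltni] := leqP i n.
  by apply: dvdp_mulr; rewrite -addnBA // exprD; apply: dvdp_mulr.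
by apply: dvdp_mull; rewrite -(subnKC (ltnW ltni)) exprD; apply: dvdp_mulr.
Qed.

Lemma dvdp_cubic_grad_exp4 d f g h :
  d %| f ^+ 2 - a *: (g * h) -> d %| g ^+ 2 - a *: (h * f) ->
  d %| h ^+ 2 - a *: (f * g) -> d %| f ^+ 4.
Proof.
move=> dX dY dZ; rewrite -(@dvdpZr _ (1 - a ^+ 3)) ?subr_eq0 1?eq_sym //.
rewrite -!mul_polyC in dX dY dZ *.
rewrite rmorphB rmorph1 rmorphXn /= (cubic_grad_exp4 _ f g h).
by rewrite !dvdp_add // dvdp_mull.
Qed.

(** The genus-one argument, for a curve v = (f, g, h) without common zeros.  The
    gradient N = (X, Y, Z) of the cubic along v is orthogonal to v, by the Euler
    relation, and to v', by differentiation; hence it is parallel to v x v'.  As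
    N has no common zeros either, v x v' = q N with q a polynomial: q dt is the
    pull-back of the invariant differential of the elliptic curve.  If v has
    degree m, then v x v' has degree less than 2 m, while N has degree exactly
    2 m because its coefficients of degree 2 m are the gradient at the leading
    coefficients of v.  So q = 0. *)
Lemma cubic_curve_const_coprime u v w f g h :
  u * f + v * g + w * h = 1 ->
  f ^+ 3 + g ^+ 3 + h ^+ 3 = (3%:R * a) *: (f * g * h) ->
  f * g^`() = g * f^`().
Proof.
move=> bez Cfgh.
set X := f ^+ 2 - a *: (g * h); set Y := g ^+ 2 - a *: (h * f).
set Z := h ^+ 2 - a *: (f * g).
pose P := g * h^`() - h * g^`(); pose Q := h * f^`() - f * h^`().
pose R := f * g^`() - g * f^`().
have L3P : 3%:R != 0 :> {poly L} by rewrite -polyC_natr polyC_eq0.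
have grad_v : f * X + g * Y + h * Z = 0.
  transitivity (f ^+ 3 + g ^+ 3 + h ^+ 3 - (3%:R * a) *: (f * g * h));
    last by rewrite Cfgh subrr.
  by rewrite /X /Y /Z -!mul_polyC rmorphM /= polyC_natr; ring.
have grad_dv : f^`() * X + g^`() * Y + h^`() * Z = 0.
  apply: (mulfI L3P); rewrite mulr0.
  have /(congr1 (@deriv L)) := Cfgh.
  rewrite !derivE /= => /eqP; rewrite -subr_eq0 => /eqP <-.
  rewrite /X /Y /Z -!mul_polyC rmorphM /= polyC_natr; ring.
have XQ : X * Q = Y * P.
  apply/eqP; rewrite -subr_eq0; apply/eqP.
  transitivity (h * (f^`() * X + g^`() * Y + h^`() * Z)
                - h^`() * (f * X + g * Y + h * Z)); last first.
    by rewrite grad_v grad_dv !mulr0 subrr.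
  by rewrite /P /Q; ring.
have YR : Y * R = Z * Q.
  apply/eqP; rewrite -subr_eq0; apply/eqP.
  transitivity (f * (f^`() * X + g^`() * Y + h^`() * Z)
                - f^`() * (f * X + g * Y + h * Z)); last first.
    by rewrite grad_v grad_dv !mulr0 subrr.
  by rewrite /R /Q; ring.
have ZP : Z * P = X * R.
  apply/eqP; rewrite -subr_eq0; apply/eqP.
  transitivity (g * (f^`() * X + g^`() * Y + h^`() * Z)
                - g^`() * (f * X + g * Y + h * Z)); last first.
    by rewrite grad_v grad_dv !mulr0 subrr.
  by rewrite /P /R; ring.
(* X, Y, Z are comaximal: a common divisor divides f^4, g^4 and h^4, hence a
   power of the Bezout relation for f, g, h. *)
pose D := gcdp (gcdp X Y) Z.
have [U [V [W bezN]]] : exists U V W, U * X + V * Y + W * Z = 1.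
  have dX : D %| X by rewrite (dvdp_trans (dvdp_gcdl _ _)) ?dvdp_gcdl.
  have dY : D %| Y by rewrite (dvdp_trans (dvdp_gcdl _ _)) ?dvdp_gcdr.
  have dZ : D %| Z by rewrite dvdp_gcdr.
  have dexp k q : D %| q ^+ 4 -> D %| (k * q) ^+ 4.
    by rewrite exprMn; apply: dvdp_mull.
  have D1 : D %| 1.
    rewrite -[1](expr1n _ (4 + 4 + 4)) -bez.
    apply: dvdp_exprD; first apply: dvdp_exprD.
    - exact/dexp/(dvdp_cubic_grad_exp4 dX dY dZ).
    - exact/dexp/(dvdp_cubic_grad_exp4 dY dZ dX).
    - exact/dexp/(dvdp_cubic_grad_exp4 dZ dX dY).
  have /Bezout_eq1_coprimepP[[s t] /= st] : coprimep (gcdp X Y) Z.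
    by rewrite coprimep_def -dvdp1.
  have [U [V UV]] := Bezoutp_eq X Y.
  by exists (s * U), (s * V), t; rewrite -!mulrA -mulrDr UV.
(* The multiplier q is obtained from P, Q, R by the Bezout coefficients of
   X, Y, Z, which avoids dividing by any of them. *)
pose q := U * P + V * Q + W * R.
have Pq : P = q * X.
  transitivity ((U * X + V * Y + W * Z) * P); first by rewrite bezN mul1r.
  rewrite /q !mulrDl -!(mulrA _ _ P) -XQ ZP; ring.
have Qq : Q = q * Y.
  transitivity ((U * X + V * Y + W * Z) * Q); first by rewrite bezN mul1r.
  rewrite /q !mulrDl -!(mulrA _ _ Q) XQ -YR; ring.
have Rq : R = q * Z.
  transitivity ((U * X + V * Y + W * Z) * R); first by rewrite bezN mul1r.
  rewrite /q !mulrDl -!(mulrA _ _ R) -ZP YR; ring.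
have [q0|q0] := eqVneq q 0.
  by apply/eqP; rewrite -subr_eq0 -/R Rq q0 mul0r.
pose m := (maxn (size f) (maxn (size g) (size h))).-1.
have [sf sg sh] : [/\ size f <= m.+1, size g <= m.+1 & size h <= m.+1]%N.
  by split; apply: leq_trans (leqSpred _); rewrite !leq_max leqnn ?orbT.
have size_wr (s t : {poly L}) : (size s <= m.+1)%N -> (size t <= m.+1)%N ->
    (size (s * t^`() - t * s^`())%R <= m + m)%N.
  move=> ss st; have szM (p r : {poly L}) : (size p <= m.+1 -> size r <= m.+1 ->
      size (p * r^`())%R <= m + m)%N.
    move=> sp sr; have [->|r0] := eqVneq r 0.
      by rewrite deriv0 mulr0 size_poly0.
    apply: leq_trans (size_polyMleq _ _) _.
    rewrite -subn1 leq_subLR add1n -addSn leq_add //.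
    by rewrite -ltnS (leq_trans (lt_size_deriv r0)).
  by rewrite (leq_trans (size_polyD _ _)) // geq_max size_polyN !szM.
(* If q <> 0, no component of N reaches degree 2 m, so the leading coefficients
   of f, g, h form a singular point of the cubic. *)
have top (s r t : {poly L}) :
    (size s <= m.+1)%N -> (size r <= m.+1)%N -> (size t <= m.+1)%N ->
    (size (q * (s ^+ 2 - a *: (r * t)))%R <= m + m)%N ->
    s`_m ^+ 2 = a * (r`_m * t`_m).
  move=> ss sr st sq; apply/eqP; rewrite -subr_eq0; apply/eqP.
  transitivity ((s ^+ 2 - a *: (r * t))`_(m + m)).
    by rewrite coefB coefZ expr2 !coefM_top.
  rewrite nth_default //; have [->|N0] := eqVneq (s ^+ 2 - a *: (r * t)) 0.
    by rewrite size_poly0.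
  apply: leq_trans sq; rewrite size_mul // -[X in (X <= _)%N]add0n.
  by case: (size q) (size_poly_gt0 q) => [|k _]; rewrite ?q0 // addSn leq_add2r.
have ef : f`_m ^+ 2 = a * (g`_m * h`_m).
  by apply: top; rewrite // -/X -Pq size_wr.
have eg : g`_m ^+ 2 = a * (h`_m * f`_m).
  by apply: top; rewrite // -/Y -Qq size_wr.
have eh : h`_m ^+ 2 = a * (f`_m * g`_m).
  by apply: top; rewrite // -/Z -Rq size_wr.
have f0 := cubic_singular_eq0 a3 ef eg eh.
have g0 := cubic_singular_eq0 a3 eg eh ef.
have h0 := cubic_singular_eq0 a3 eh ef eg.
have cst (s : {poly L}) : (size s <= m.+1)%N -> s`_m = 0 -> (size s <= m)%N.
  move=> ss s0; rewrite -[(_ <= _)%N]negbK -ltnNge; apply/negP => lt_ms.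
  have es : size s = m.+1 by apply/eqP; rewrite eqn_leq ss.
  by move: s0; rewrite -[m]/(m.+1.-1) -es -lead_coefE => /eqP;
    rewrite lead_coef_eq0 => /eqP s0; rewrite s0 size_poly0 in es.
have m0 : m = 0%N.
  apply/eqP; rewrite -leqn0 leqNgt; apply/negP => m_gt0.
  have: (maxn (size f) (maxn (size g) (size h)) <= m)%N.
    by rewrite !geq_max !cst.
  by rewrite leqNgt ltn_predL (leq_trans m_gt0 (leq_pred _)).
have zero (s : {poly L}) : (size s <= m.+1)%N -> s`_m = 0 -> s = 0.
  by move=> ss s0; apply/eqP; rewrite -size_poly_leq0 -m0 cst.
by rewrite (zero f) // (zero g) // !mul0r.
Qed.

(** Multiplying f and g by d multiplies their Wronskian by d^2, so a common
    factor can be divided out. *)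
Lemma cubic_curve_const f g h :
  f ^+ 3 + g ^+ 3 + h ^+ 3 = (3%:R * a) *: (f * g * h) ->
  f * g^`() = g * f^`().
Proof.
move=> Cfgh; have [/eqP|d0] := eqVneq (gcdp (gcdp f g) h) 0.
  by rewrite gcdp_eq0 gcdp_eq0 => /andP[/andP[/eqP-> /eqP->] _].
pose d := gcdp (gcdp f g) h; rewrite -/d in d0.
have /divpK ef : d %| f by rewrite (dvdp_trans (dvdp_gcdl _ _)) ?dvdp_gcdl.
have /divpK eg : d %| g by rewrite (dvdp_trans (dvdp_gcdl _ _)) ?dvdp_gcdr.
have /divpK eh : d %| h by rewrite dvdp_gcdr.
move: (f %/ d) (g %/ d) (h %/ d) ef eg eh => f1 g1 h1 ef eg eh.
have [s [t [r bez]]] : exists s t r, s * f1 + t * g1 + r * h1 = 1.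
  have [s [t st]] := Bezoutp_eq f g.
  have [s' [t' st']] := Bezoutp_eq (gcdp f g) h.
  have ed : s' * (s * f + t * g) + t' * h = d by rewrite st st'.
  exists (s' * s), (s' * t), t'; apply: (mulIf d0); clearbody d.
  rewrite mul1r -[RHS]ed -ef -eg -eh; ring.
have C1 : f1 ^+ 3 + g1 ^+ 3 + h1 ^+ 3 = (3%:R * a) *: (f1 * g1 * h1).
  have d3 : d ^+ 3 != 0 by rewrite expf_neq0.
  apply: (mulIf d3); rewrite -mul_polyC.
  move: Cfgh; rewrite -ef -eg -eh -mul_polyC => E.
  transitivity ((f1 * d) ^+ 3 + (g1 * d) ^+ 3 + (h1 * d) ^+ 3); first by ring.
  by rewrite E; ring.
have w1 := cubic_curve_const_coprime bez C1.
rewrite -ef -eg !derivM.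
transitivity (d ^+ 2 * (f1 * g1^`()) + f1 * g1 * d * d^`()); first by ring.
by rewrite w1; ring.
Qed.

End PlaneCubic.

(** * Homogeneous components and degrees *)

Section MpolyDegree.
Variables (n : nat) (K : idomainType).
Implicit Types p q : {mpoly K[n]}.

Lemma msize_leP p k :
  reflect (forall m, (k <= mdeg m)%N -> p@_m = 0) (msize p <= k)%N.
Proof.
apply: (iffP idP) => [sp m km|H].
  by apply/memN_msupp_eq0/msize_mdeg_ge/(leq_trans sp).
rewrite msizeE; apply/bigmax_leqP_seq => m mp _; rewrite ltnNge.
apply/negP => /H.
by apply/eqP; rewrite -mcoeff_msupp.
Qed.

Lemma mcoeff_pihomog d p m :
  (pihomog mdeg d p)@_m = if mdeg m == d then p@_m else 0.
Proof.
rewrite pihomogE raddf_sum /=; case: ifP => md; last first.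
  rewrite big1 // => m' m'd; rewrite mcoeffZ mcoeffX.
  by case: (m' =P m) m'd => [->|_ _]; rewrite ?md ?mulr0.
rewrite big_mkcond /= [in RHS](mpolyE p) raddf_sum /=.
apply: eq_bigr => m' _; rewrite mcoeffZ mcoeffX.
by case: (m' =P m) => [->|_]; rewrite ?md // mulr0 if_same.
Qed.

Lemma pihomog_mderiv d p i :
  pihomog mdeg d p^`M(i) = (pihomog mdeg d.+1 p)^`M(i).
Proof.
apply/mpolyP => m; rewrite mcoeff_mderiv !mcoeff_pihomog mcoeff_mderiv.
by rewrite mdegD mdeg1 addn1 eqSS; case: ifP; rewrite ?mul0rn.
Qed.

Lemma msize_mderiv k p i : (msize p <= k.+1)%N -> (msize p^`M(i) <= k)%N.
Proof.
move=> /msize_leP sp; apply/msize_leP => m km.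
rewrite mcoeff_mderiv sp ?mul0rn //.
by rewrite mdegD mdeg1 addn1.
Qed.

Lemma msizeM_bound k l p q :
  (msize p <= k)%N -> (msize q <= l.+1)%N -> (msize (p * q) <= k + l)%N.
Proof.
move=> sp sq; have [->|p0] := eqVneq p 0; first by rewrite mul0r msize0.
have [->|q0] := eqVneq q 0; first by rewrite mulr0 msize0.
by rewrite msizeM // -subn1 leq_subLR add1n -addnS leq_add.
Qed.

Lemma msizeB_bound k p q :
  (msize p <= k)%N -> (msize q <= k)%N -> (msize (p - q) <= k)%N.
Proof.
move=> sp sq; apply: leq_trans (msizeD_le _ _) _.
by rewrite geq_max msizeN sp.
Qed.

Lemma pihomog_small d p : (msize p <= d)%N -> pihomog mdeg d p = 0.
Proof.
move=> /msize_leP sp; apply/mpolyP => m; rewrite mcoeff_pihomog mcoeff0.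
by case: eqP => // e; rewrite sp ?e.
Qed.

(** Only the product of the two top components reaches degree k + l. *)
Lemma pihomogM_top k l p q : (msize p <= k.+1)%N -> (msize q <= l.+1)%N ->
  pihomog mdeg (k + l) (p * q) = pihomog mdeg k p * pihomog mdeg l q.
Proof.
move=> sp sq; have low j (r : {mpoly K[n]}) : (msize r <= j.+1)%N ->
    (msize (r - pihomog mdeg j r) <= j)%N.
  move=> /msize_leP sr; apply/msize_leP => m.
  rewrite leq_eqVlt mcoeffB mcoeff_pihomog [mdeg m == j]eq_sym.
  move=> /predU1P[->|lt_jm]; first by rewrite eqxx subrr.
  by rewrite ltn_eqF // subr0 sr.
have -> : p * q = pihomog mdeg k p * pihomog mdeg l q
    + ((p - pihomog mdeg k p) * q + (q - pihomog mdeg l q) * pihomog mdeg k p).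
  by ring.
have sP : (msize (pihomog mdeg k p) <= k.+1)%N.
  apply/msize_leP => m; rewrite mcoeff_pihomog => /ltn_eqF km.
  by rewrite [mdeg m == k]eq_sym km.
rewrite !pihomogD pihomog_dE; last by rewrite dhomogM ?pihomogP.
rewrite (pihomog_small (p := (p - _) * q)) ?msizeM_bound ?low // add0r.
rewrite (pihomog_small (p := _ * pihomog _ _ _)) ?addr0 //.
by rewrite addnC msizeM_bound ?low.
Qed.

Lemma pihomog_lead p : p != 0 -> pihomog mdeg (msize p).-1 p != 0.
Proof.
move=> p0; apply/eqP => /(congr1 (mcoeff (mlead p))) /eqP.
by rewrite mcoeff_pihomog -(mlead_deg p0) /= eqxx mcoeff0 mleadc_eq0 (negPf p0).
Qed.

End MpolyDegree.

(** * Gradients, the chain rule and curves on the cubic cone *)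

Section Gradient.
Variable K : fieldType.
Hypothesis K0 : [pchar K] =i pred0.
Local Notation P := {mpoly K[3]}.
Implicit Types (p q u : P) (t : 3.-tuple P).

(** Characteristic 0 enters here: each nonconstant coefficient of p, multiplied
    by a positive integer, is a coefficient of a partial derivative. *)
Lemma mderiv_eq0 p : (forall i, p^`M(i) = 0) -> p = (p@_0)%:MP.
Proof.
move=> dp0; apply/mpolyP => m; rewrite mcoeffC.
have [->|m0] := eqVneq m 0%MM; first by rewrite mulr1.
rewrite mulr0.
have [i mi] : exists i, m i != 0%N.
  apply/existsP; rewrite -negb_forall; apply: contra m0 => /forallP m0.
  by apply/eqP/mnmP => i; rewrite mnm0E; apply/eqP.
have := congr1 (mcoeff (m - U_(i))%MM) (dp0 i).
have Um : (U_(i) <= m)%MM.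
  by apply/mnm_lepP => j; rewrite mnm1E; case: eqP => [<-|//]; rewrite lt0n.
rewrite mcoeff_mderiv mcoeff0 submK // => /eqP.
by rewrite -mulr_natr mulf_eq0 (pcharf0P K).1 //= orbF => /eqP.
Qed.

Lemma mderiv_comp p t i :
  (p \mPo t)^`M(i) = \sum_(j < 3) (p^`M(j) \mPo t) * (t`_j)^`M(i).
Proof.
elim/mpoly_alg_ind: p => [|k|c p q Ep Eq|p q Ep Eq].
- rewrite comp_mpoly1 -mpolyC1 mderivC big1 // => j _.
  by rewrite mderivC comp_mpoly0 mul0r.
- rewrite comp_mpolyXU (bigD1 k) //= big1 => [|j jk].
    by rewrite mderivU eqxx comp_mpoly1 mul1r addr0.
  by rewrite mderivU (negPf jk) comp_mpoly0 mul0r.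
- rewrite comp_mpolyD comp_mpolyZ mderivD mderivZ Ep Eq scaler_sumr.
  rewrite -big_split /=.
  apply: eq_bigr => j _; rewrite mderivD mderivZ comp_mpolyD comp_mpolyZ.
  by rewrite mulrDl scalerAl.
- rewrite rmorphM /= mderivM Ep Eq mulr_suml mulr_sumr -big_split /=.
  apply: eq_bigr => j _; rewrite mderivM comp_mpolyD !rmorphM /=; ring.
Qed.

(** The chain rule for Jacobians: the matrix on the left is the product of the
    two Jacobian matrices. *)
Lemma jacobian_comp p q u t :
  jacobian (p \mPo t) (q \mPo t) (u \mPo t) =
  (jacobian p q u \mPo t) * jacobian t`_0 t`_1 t`_2.
Proof.
rewrite /jacobian -det_map_mx -det_mulmx; congr (\det _).
apply/matrixP => i j; rewrite !mxE.
transitivity (([:: p; q; u]`_i \mPo t)^`M(j)).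
  by case: (ord3 i) => ->.
rewrite mderiv_comp; apply: eq_bigr => k _; rewrite !mxE.
by congr (_ * _^`M(_)); case: (ord3 k) => ->.
Qed.

Lemma mpoly_mulI p q : p * q = 1 -> q = (q@_0)%:MP /\ q@_0 != 0.
Proof.
move=> /mpoly_intro_unit /andP[/eqP eq uq]; split => //.
by rewrite -unitfE.
Qed.

Section Shift.
Variables (L : fieldType) (e : {rmorphism P -> L}).

(** Taylor expansion X_k |-> X_k + t: it turns the k-th partial derivative
    into d/dt, so that results on univariate polynomials over a field L
    containing the polynomial ring apply to partial derivatives. *)
Definition shift k : P -> {poly L} :=
  mmap (polyC \o e \o @mpolyC 3 K) (fun i => (e 'X_i)%:P + (i == k)%:R *: 'X).

HB.instance Definition _ k := GRing.RMorphism.on (shift k).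

Lemma shiftX k i : shift k 'X_i = (e 'X_i)%:P + (i == k)%:R *: 'X.
Proof. by rewrite /shift mmapX mmap1U. Qed.

Lemma shiftZ k c p : shift k (c *: p) = e c%:MP *: shift k p.
Proof. by rewrite /shift mmapZ /= mul_polyC. Qed.

Lemma shift_at0 k p : (shift k p).[0] = e p.
Proof.
elim/mpoly_alg_ind: p => [|i|c p q Ep Eq|p q Ep Eq].
- by rewrite !rmorph1 hornerC.
- by rewrite shiftX !hornerE.
- rewrite rmorphD /= shiftZ hornerD hornerZ Ep Eq rmorphD /= -mul_mpolyC.
  by rewrite rmorphM.
- by rewrite rmorphM /= hornerM Ep Eq rmorphM.
Qed.

Lemma deriv_shift k p : (shift k p)^`() = shift k p^`M(k).
Proof.
elim/mpoly_alg_ind: p => [|i|c p q Ep Eq|p q Ep Eq].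
- by rewrite rmorph1 -mpolyC1 mderivC rmorph0 derivC.
- rewrite shiftX mderivU eq_sym derivD derivC derivZ derivX add0r.
  by case: eqP; rewrite ?scale1r ?scale0r ?rmorph1 ?rmorph0.
- by rewrite mderivD mderivZ !rmorphD /= !shiftZ derivD derivZ Ep Eq.
- by rewrite rmorphM /= derivM Ep Eq mderivM rmorphD !rmorphM /=.
Qed.

(** The statement on univariate polynomials, applied to the shifts of f, g, h
    and evaluated at t = 0. *)
Lemma cubic_cone_wronskian_emb (a : K) (f g h : P) k :
  injective e -> a ^+ 3 != 1 ->
  f ^+ 3 + g ^+ 3 + h ^+ 3 = (3%:R * a) *: (f * g * h) ->
  f * g^`M(k) = g * f^`M(k).
Proof.
move=> e_inj a3 /(congr1 (shift k)).
rewrite shiftZ !rmorphD /= !rmorphXn /= mpolyCM !rmorphM /=.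
rewrite mpolyC_nat rmorph_nat => C.
have L3 : 3%:R != 0 :> L.
  rewrite -(rmorph_nat e) raddf_eq0 // -mpolyC_nat mpolyC_eq0.
  by rewrite (pcharf0P K).1.
have b3 : e a%:MP ^+ 3 != 1.
  rewrite -rmorphXn -(rmorph1 e) (inj_eq e_inj) -rmorphXn -mpolyC1.
  by rewrite -subr_eq0 -mpolyCB mpolyC_eq0 subr_eq0.
have := cubic_curve_const L3 b3 C; rewrite !deriv_shift -!rmorphM /=.
by move=> /(congr1 (horner^~ 0)); rewrite !shift_at0 => /e_inj.
Qed.

End Shift.

Lemma cubic_cone_wronskian (a : K) (f g h : P) k : a ^+ 3 != 1 ->
  f ^+ 3 + g ^+ 3 + h ^+ 3 = (3%:R * a) *: (f * g * h) ->
  f * g^`M(k) = g * f^`M(k).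
Proof.
apply: (@cubic_cone_wronskian_emb _ (@FracField.tofrac P)).
by move=> p q /eqP; rewrite tofrac_eq => /eqP.
Qed.

End Gradient.

(** * Elliptic triples have degree one *)

Lemma sum_ord3 (V : nmodType) (F : 'I_3 -> V) : \sum_i F i = F 0 + F 1 + F 2.
Proof.
rewrite !big_ord_recl big_ord0 addr0 addrA.
by congr (F _ + F _ + F _); apply: val_inj.
Qed.

Section EllipticTriples.
Variables (K : fieldType) (alpha : K).
Hypotheses (K0 : [pchar K] =i pred0) (alpha3 : alpha ^+ 3 != 1).
Local Notation P := {mpoly K[3]}.
Local Notation C := (elliptic_C alpha).
Local Notation br := (elliptic_br alpha).
Local Notation x := ('X_0 : P).
Local Notation y := ('X_1 : P).
Local Notation z := ('X_2 : P).
Implicit Types f g h : P.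

Definition elliptic_triple f g h : Prop :=
  [/\ br f g = h ^+ 2 - alpha *: (f * g), br g h = f ^+ 2 - alpha *: (g * h)
    & br h f = g ^+ 2 - alpha *: (h * f)].

Lemma elliptic_triple_rot f g h :
  elliptic_triple f g h -> elliptic_triple g h f.
Proof. by case. Qed.

Lemma cone_rot f g h :
  f ^+ 3 + g ^+ 3 + h ^+ 3 = (3%:R * alpha) *: (f * g * h) ->
  g ^+ 3 + h ^+ 3 + f ^+ 3 = (3%:R * alpha) *: (g * h * f).
Proof. by move=> e; rewrite -[g * h * f]mulrC mulrA -e addrC addrA. Qed.

Lemma K_natr_neq0 n : n.+1%:R != 0 :> K.
Proof. by rewrite (pcharf0P K).1. Qed.

Lemma elliptic_C_grad :
  [/\ C^`M(0) = x ^+ 2 - alpha *: (y * z), C^`M(1) = y ^+ 2 - alpha *: (z * x)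
    & C^`M(2) = z ^+ 2 - alpha *: (x * y)].
Proof.
have [-> -> ->] := elliptic_C_deriv alpha.
by rewrite mulVf ?K_natr_neq0 // !scale1r.
Qed.

Lemma elliptic_C_comp f g h : C \mPo [tuple f; g; h] =
  (3%:R^-1 : K) *: (f ^+ 3 + g ^+ 3 + h ^+ 3) - alpha *: (f * g * h).
Proof.
rewrite /elliptic_C rmorphB /= !comp_mpolyZ !rmorphD /=.
by rewrite !rmorphXn !rmorphM /= !comp_mpolyXU.
Qed.

(** Cramer's identity for the vectors grad f, grad g, grad h and w = grad C:
    det(w, grad g, grad h) grad f + ... = J(f, g, h) w.  The three coefficients
    are the brackets {g, h}, {h, f}, {f, g}, that is the partial derivatives of
    C at (f, g, h), so the left-hand side is the gradient of C(f, g, h). *)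
Lemma grad_C_triple f g h i : elliptic_triple f g h ->
  (C \mPo [tuple f; g; h])^`M(i) = jacobian f g h * C^`M(i).
Proof.
move=> [fg gh hf]; rewrite mderiv_comp sum_ord3.
have [C0 C1 C2] := elliptic_C_grad.
have -> : C^`M(0) \mPo [tuple f; g; h] = br g h.
  by rewrite C0 gh rmorphB rmorphXn /= comp_mpolyZ rmorphM /= !comp_mpolyXU.
have -> : C^`M(1) \mPo [tuple f; g; h] = br h f.
  by rewrite C1 hf rmorphB rmorphXn /= comp_mpolyZ rmorphM /= !comp_mpolyXU.
have -> : C^`M(2) \mPo [tuple f; g; h] = br f g.
  by rewrite C2 fg rmorphB rmorphXn /= comp_mpolyZ rmorphM /= !comp_mpolyXU.
rewrite /= /elliptic_br; move: (elliptic_C alpha) => c; rewrite !jacobianE.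
by case: (ord3 i) => ->; ring.
Qed.

Lemma C_triple f g h j : elliptic_triple f g h -> jacobian f g h = j%:MP ->
  exists b, C \mPo [tuple f; g; h] = j *: C + b%:MP.
Proof.
move=> fgh Jj; exists (C \mPo [tuple f; g; h] - j *: C)@_0.
apply/eqP; rewrite addrC -subr_eq; apply/eqP; apply: mderiv_eq0 => // i.
by rewrite mderivB mderivZ grad_C_triple // Jj mul_mpolyC subrr.
Qed.

(** On the cone the gradients of f, g, h are pairwise parallel, so all brackets
    vanish; the relations of a triple then say that (f, g, h) is a zero of the
    gradient of the cubic. *)
Lemma triple_on_cone f g h : elliptic_triple f g h ->
  f ^+ 3 + g ^+ 3 + h ^+ 3 = (3%:R * alpha) *: (f * g * h) -> f = 0.
Proof.
have br0 u v w : u ^+ 3 + v ^+ 3 + w ^+ 3 = (3%:R * alpha) *: (u * v * w) ->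
    br u v = 0.
  move=> cone; have W k := cubic_cone_wronskian K0 k alpha3 cone.
  have [->|u0] := eqVneq u 0; first exact: bider0 (elliptic_brL alpha) v.
  apply: (mulfI u0); rewrite mulr0 /elliptic_br; move: (elliptic_C alpha) => c.
  rewrite jacobianE.
  transitivity (c^`M(0) * (u^`M(1) * (u * v^`M(2)) - u^`M(2) * (u * v^`M(1)))
    + c^`M(1) * (u^`M(2) * (u * v^`M(0)) - u^`M(0) * (u * v^`M(2)))
    + c^`M(2) * (u^`M(0) * (u * v^`M(1)) - u^`M(1) * (u * v^`M(0)))).
    by ring.
  by rewrite !W; ring.
move=> [fg gh hf] cone.
have a3 : alpha%:MP ^+ 3 != 1 :> P.
  by rewrite -rmorphXn -mpolyC1 -subr_eq0 -mpolyCB mpolyC_eq0 subr_eq0.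
have eqv (u v : P) : 0 = u ^+ 2 - alpha *: v -> u ^+ 2 = alpha%:MP * v.
  by move/esym/eqP; rewrite subr_eq0 mul_mpolyC => /eqP.
apply: (cubic_singular_eq0 a3 (y := g) (z := h)); apply: eqv.
- by rewrite -gh (br0 _ _ _ (cone_rot cone)).
- by rewrite -hf (br0 _ _ _ (cone_rot (cone_rot cone))).
- by rewrite -fg (br0 _ _ _ cone).
Qed.

Lemma elliptic_C_grad_homog i : C^`M(i) \is 2.-homog.
Proof.
have X1 j : ('X_j : P) \is 1.-homog by rewrite dhomogX /= mdeg1.
have X2 j k : ('X_j * 'X_k : P) \is 2.-homog by exact: dhomogM (X1 j) (X1 k).
have [C0 C1 C2] := elliptic_C_grad.
by case: (ord3 i) => ->; rewrite ?C0 ?C1 ?C2 expr2 rpredB ?rpredZ ?X2.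
Qed.

Lemma dhomog_size d (p : P) : p \is d.-homog -> (msize p <= d.+1)%N.
Proof.
move=> hp; apply/msize_leP => m dm; apply: (dhomog_nemf_coeff hp).
by rewrite neq_ltn dm orbT.
Qed.

(** Each term of the bracket is a product of two partial derivatives, of degree
    at most m, and one of the quadrics C^`M(i). *)
Lemma pihomog_br m f g : (msize f <= m.+2)%N -> (msize g <= m.+2)%N ->
  pihomog mdeg (m.+1 + m.+1) (br f g) =
  br (pihomog mdeg m.+1 f) (pihomog mdeg m.+1 g).
Proof.
move=> sf sg; rewrite /elliptic_br !jacobianE.
have -> : (m.+1 + m.+1 = m + (m + 2))%N by rewrite addn2 addSn !addnS.
have df i := msize_mderiv i sf; have dg i := msize_mderiv i sg.
have dC i := dhomog_size (elliptic_C_grad_homog i).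
have dgC i j : (msize (g^`M(i) * C^`M(j)) <= (m + 2).+1)%N.
  by rewrite -addSn msizeM_bound.
have top i j k :
    pihomog mdeg (m + (m + 2))
      (f^`M(i) * (g^`M(j) * C^`M(k) - g^`M(k) * C^`M(j))) =
    (pihomog mdeg m.+1 f)^`M(i) * ((pihomog mdeg m.+1 g)^`M(j) * C^`M(k)
       - (pihomog mdeg m.+1 g)^`M(k) * C^`M(j)).
  rewrite pihomogM_top ?df // ?msizeB_bound // pihomogB !pihomogM_top //.
  by rewrite !(pihomog_dE (elliptic_C_grad_homog _)) !pihomog_mderiv.
by rewrite pihomogD pihomogB !top.
Qed.

Lemma elliptic_triple_pihomog m f g h :
  (msize f <= m.+2)%N -> (msize g <= m.+2)%N -> (msize h <= m.+2)%N ->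
  elliptic_triple f g h ->
  elliptic_triple (pihomog mdeg m.+1 f) (pihomog mdeg m.+1 g)
    (pihomog mdeg m.+1 h).
Proof.
move=> sf sg sh [fg gh hf].
have top (u v w : P) :
    (msize u <= m.+2)%N -> (msize v <= m.+2)%N -> (msize w <= m.+2)%N ->
    br u v = w ^+ 2 - alpha *: (u * v) ->
    br (pihomog mdeg m.+1 u) (pihomog mdeg m.+1 v) = pihomog mdeg m.+1 w ^+ 2
      - alpha *: (pihomog mdeg m.+1 u * pihomog mdeg m.+1 v).
  move=> su sv sw e; rewrite -pihomog_br // e pihomogB linearZ /= expr2.
  by rewrite !pihomogM_top.
by split; apply: top.
Qed.

(** The leading components of a triple of degree m.+2 would form a nonzero
    triple on the cone, since j C + b has no part of degree 3 m + 6. *)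
Lemma elliptic_triple_deg1 f g h j : elliptic_triple f g h ->
  jacobian f g h = j%:MP ->
  [/\ msize f <= 2, msize g <= 2 & msize h <= 2]%N.
Proof.
move=> fgh /(C_triple fgh)[b Cfgh].
pose s := maxn (msize f) (maxn (msize g) (msize h)).
have [sf sg sh] : [/\ msize f <= s, msize g <= s & msize h <= s]%N.
  by split; rewrite !leq_max leqnn ?orbT.
have [s2|] := leqP s 2.
  by split; [apply: leq_trans sf _ | apply: leq_trans sg _
            | apply: leq_trans sh _].
case Es: s => [|[|[|m]]] //= _; rewrite Es in sf sg sh.
have tri := elliptic_triple_pihomog sf sg sh fgh.
have cone : pihomog mdeg m.+2 f ^+ 3 + pihomog mdeg m.+2 g ^+ 3
  + pihomog mdeg m.+2 h ^+ 3 = (3%:R * alpha) *: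
    (pihomog mdeg m.+2 f * pihomog mdeg m.+2 g * pihomog mdeg m.+2 h).
  have topM3 (u v w : P) :
      (msize u <= m.+3)%N -> (msize v <= m.+3)%N -> (msize w <= m.+3)%N ->
      pihomog mdeg (m.+2 + m.+2 + m.+2) (u * v * w) =
      pihomog mdeg m.+2 u * pihomog mdeg m.+2 v * pihomog mdeg m.+2 w.
    move=> su sv sw; rewrite pihomogM_top // ?pihomogM_top //.
    by rewrite -addSn msizeM_bound.
  have small : pihomog mdeg (m.+2 + m.+2 + m.+2) (j *: C + b%:MP) = 0.
    have C3 : C \is 3.-homog.
      have X1 i : ('X_i : P) \is 1.-homog by rewrite dhomogX /= mdeg1.
      have X3 i k l : ('X_i * 'X_k * 'X_l : P) \is 3.-homog.
        exact: dhomogM (dhomogM (X1 i) (X1 k)) (X1 l).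
      rewrite /elliptic_C !exprSr !expr0 !mul1r.
      by rewrite rpredB ?rpredZ ?rpredD ?X3.
    apply: pihomog_small.
    apply: leq_trans (_ : 4 <= _)%N; last by rewrite !addSn !addnS.
    apply: leq_trans (msizeD_le _ _) _.
    rewrite geq_max (leq_trans (msizeZ_le _ _)).
      by rewrite mmeasureC; case: (b != 0).
    exact: dhomog_size.
  move: small; rewrite -Cfgh elliptic_C_comp pihomogB !linearZ /=.
  rewrite !pihomogD !exprSr !expr0 !mul1r !topM3 // scalerN => /eqP.
  rewrite subr_eq0 => /eqP e; apply: (scalerI (invr_neq0 (K_natr_neq0 2))).
  by rewrite e scalerA mulrA mulVf ?K_natr_neq0 // mul1r.
have low (u : P) : (msize u <= m.+3)%N -> pihomog mdeg m.+2 u = 0 ->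
    (msize u <= m.+2)%N.
  rewrite leq_eqVlt => /predU1P[e top0|//].
  have u0 : u != 0 by rewrite -msize_poly_eq0 e.
  by have := pihomog_lead u0; rewrite e /= top0 eqxx.
suff : (s <= m.+2)%N by rewrite Es ltnn.
rewrite !geq_max !low //.
- exact: triple_on_cone (elliptic_triple_rot (elliptic_triple_rot tri))
    (cone_rot (cone_rot cone)).
- exact: triple_on_cone (elliptic_triple_rot tri) (cone_rot cone).
- exact: triple_on_cone tri cone.
Qed.

End EllipticTriples.

(** * Linear triples and the Hessian covariant *)

Section LinearTriples.
Variables (K : fieldType) (alpha : K).
Hypotheses (K0 : [pchar K] =i pred0) (alpha3 : alpha ^+ 3 != 1).
Local Notation P := {mpoly K[3]}.
Local Notation C := (elliptic_C alpha).
Local Notation br := (elliptic_br alpha).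
Local Notation x := ('X_0 : P).
Local Notation y := ('X_1 : P).
Local Notation z := ('X_2 : P).
Local Notation triple := (elliptic_triple alpha).
Implicit Types (f g h : P) (a b c : 'I_3 -> K).

Definition linear_form a : P := \sum_i a i *: 'X_i.

Lemma mderiv_linear_form a i : (linear_form a)^`M(i) = (a i)%:MP.
Proof.
rewrite /linear_form raddf_sum (bigD1 i) //= big1 => [|j ji].
  by rewrite mderivZ mderivU eqxx addr0 -mul_mpolyC mulr1.
by rewrite mderivZ mderivU eq_sym (negPf ji) scaler0.
Qed.

Lemma affine_form f :
  (msize f <= 2)%N -> exists a (k : K), f = linear_form a + k%:MP.
Proof.
move=> sf; pose a i := f^`M(i)@_0.
exists a, (f - linear_form a)@_0; apply/eqP; rewrite addrC -subr_eq; apply/eqP.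
apply: mderiv_eq0 => // i; rewrite mderivB mderiv_linear_form.
by rewrite [f^`M(i)]msize1_polyC ?subrr // msize_mderiv.
Qed.

Lemma meval_linear_form a v : (linear_form a).@[v] = \sum_i a i * v i.
Proof.
by rewrite raddf_sum; apply: eq_bigr => i _; rewrite /= mevalZ mevalXU.
Qed.

Lemma meval_grad f g h v : (h ^+ 2 - alpha *: (f * g)).@[v] =
  h.@[v] ^+ 2 - alpha * (f.@[v] * g.@[v]).
Proof. by rewrite mevalB mevalZ expr2 !mevalM. Qed.

(** Brackets vanish at the origin because the gradient of C does; so the
    constant terms form a singular point of the cubic. *)
Lemma triple_meval0 f g h : triple f g h -> f.@[fun=> 0] = 0.
Proof.
have br0 u v : (br u v).@[fun=> 0] = 0.
  have [C0 C1 C2] := elliptic_C_grad alpha K0.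
  rewrite /elliptic_br jacobianE C0 C1 C2.
  by rewrite !(meval_grad, mevalD, mevalN, mevalM) /= !mevalXU; ring.
have ev u v w : br u v = w ^+ 2 - alpha *: (u * v) ->
    w.@[fun=> 0] ^+ 2 = alpha * (u.@[fun=> 0] * v.@[fun=> 0]).
  move=> /(congr1 (meval (fun=> 0))); rewrite br0 meval_grad => /esym/eqP.
  by rewrite subr_eq0 => /eqP.
move=> [/ev ez /ev ex /ev ey]; exact: (cubic_singular_eq0 alpha3 ex ey ez).
Qed.

Lemma triple_linear f g h : triple f g h -> (msize f <= 2)%N ->
  exists a, f = linear_form a.
Proof.
move=> fgh /affine_form[a [k ef]]; exists a; have := triple_meval0 fgh.
rewrite ef mevalD meval_linear_form mevalC big1 => [|i _];
  last by rewrite mulr0.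
by rewrite add0r => ->; rewrite mpolyC0 addr0.
Qed.

(** The three equations are the values of the relation at the unit vectors: the
    k-th partial derivative of C is 1 at the k-th unit vector and 0 at the
    two others. *)
Lemma br_linear_forms a b c :
  br (linear_form a) (linear_form b) =
    linear_form c ^+ 2 - alpha *: (linear_form a * linear_form b) ->
  [/\ a 1 * b 2 - a 2 * b 1 = c 0 ^+ 2 - alpha * (a 0 * b 0),
      a 2 * b 0 - a 0 * b 2 = c 1 ^+ 2 - alpha * (a 1 * b 1)
    & a 0 * b 1 - a 1 * b 0 = c 2 ^+ 2 - alpha * (a 2 * b 2)].
Proof.
have [C0 C1 C2] := elliptic_C_grad alpha K0.
rewrite /elliptic_br jacobianE C0 C1 C2 !mderiv_linear_form => e.
have ev k := congr1 (meval (fun i => (i == k)%:R)) e.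
split; [move: (ev 0) | move: (ev 1) | move: (ev 2)];
  rewrite !(meval_grad, mevalD, mevalN, mevalM) /= !mevalXU !mevalC
    !meval_linear_form !sum_ord3 /= !(mulr0, mulr1, addr0, add0r) => <-; ring.
Qed.

Definition hessian f : 'M[P]_3 := \matrix_(i, j) f^`M(i)^`M(j).

(** For a linear substitution the second derivatives of t drop out, and the
    Hessian transforms as a quadratic form. *)
Lemma hessian_comp_linear f (t : 3.-tuple P) :
  (forall i : 'I_3, exists a, t`_i = linear_form a) ->
  let A := \matrix_(i, j) (t`_(i : 'I_3))^`M(j) in
  hessian (f \mPo t) = A^T *m map_mx (comp_mpoly t) (hessian f) *m A.
Proof.
move=> tlin A; apply/matrixP => i k; rewrite !mxE mderiv_comp raddf_sum /=.
under eq_bigr => j _.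
  have -> : ((f^`M(j) \mPo t) * (t`_j)^`M(i))^`M(k) =
            \sum_l A^T i j * (f^`M(j)^`M(l) \mPo t) * A l k.
    have [a ta] := tlin j.
    rewrite mderivM !mxE ta !mderiv_linear_form mderivC mulr0 addr0 mderiv_comp.
    rewrite mulr_suml; apply: eq_bigr => l _.
    by rewrite !mxE ?ta ?mderiv_linear_form; ring.
  over.
rewrite exchange_big; apply: eq_bigr => l _ /=; rewrite !mxE mulr_suml.
by apply: eq_bigr => j _; rewrite !mxE.
Qed.

(** The Hessian determinant lies in the pencil spanned by x y z and C.  Its
    component along x y z is nonzero precisely when alpha^3 <> 1, which lets
    triple_prod recover x y z from C and its Hessian. *)
Lemma det_hessian_C :
  \det (hessian C) =
  (8%:R * (1 - alpha ^+ 3)) *: (x * y * z) - (6%:R * alpha ^+ 2) *: C.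
Proof.
have [C0 C1 C2] := elliptic_C_grad alpha K0.
rewrite det3 !mxE C0 C1 C2 /elliptic_C.
rewrite !(mderivB, mderivZ, expr2, mderivM, mderivU) /=.
have e3 : (3%:R^-1 : K)%:MP * 3%:R = 1 :> P.
  by rewrite -mpolyC_nat -mpolyCM mulVf ?K_natr_neq0.
rewrite -!mul_mpolyC !mpolyCM !mpolyCB !mpolyCM mpolyC1 !mpolyC_nat.
move: (3%:R^-1)%:MP e3 => w e3.
transitivity (8%:R * (1 - alpha%:MP * alpha%:MP * alpha%:MP) * (x * y * z)
  - 6%:R * (alpha%:MP * alpha%:MP) * - (alpha%:MP * (x * y * z))
  - 2%:R * (alpha%:MP * alpha%:MP) * (w * 3%:R) * (x ^+ 3 + y ^+ 3 + z ^+ 3)).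
  by rewrite e3; ring.
ring.
Qed.

End LinearTriples.

(** * Linear triples are monomial *)

Section MonomialTriples.
Variables (K : fieldType) (alpha : K).
Hypotheses (K0 : [pchar K] =i pred0) (alpha3 : alpha ^+ 3 != 1).
Local Notation P := {mpoly K[3]}.
Local Notation C := (elliptic_C alpha).
Local Notation x := ('X_0 : P).
Local Notation y := ('X_1 : P).
Local Notation z := ('X_2 : P).
Local Notation triple := (elliptic_triple alpha).
Implicit Types (a b c : 'I_3 -> K).

Lemma linear_form_eq0 a : linear_form a = 0 -> forall i, a i = 0.
Proof.
move=> a0 i; have := mderiv_linear_form a i.
by rewrite a0 mderiv0 => /esym/eqP; rewrite mpolyC_eq0 => /eqP.
Qed.

(** C(f, g, h) = j C, and the substitution has determinant j, so comparing
    Hessian determinants gives j^2 H(f, g, h) = j^3 H.  Both C and H being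
    multiplied by j, so is x y z. *)
Lemma triple_prod a b c (j : K) :
  let f := linear_form a in let g := linear_form b in let h := linear_form c in
  triple f g h -> jacobian f g h = j%:MP -> j != 0 ->
  f * g * h = j *: (x * y * z).
Proof.
move=> f g h fgh Jj j0; pose t := [tuple f; g; h].
have lin0 d : (linear_form d).@[fun=> 0] = 0 :> K.
  by rewrite meval_linear_form big1 // => i _; rewrite mulr0.
have Ct : C \mPo t = j *: C.
  have [k e] := C_triple K0 fgh Jj; rewrite e.
  (* The constant k is the value of both sides at the origin. *)
  move/(congr1 (meval (fun=> 0))): e; rewrite elliptic_C_comp /elliptic_C.
  rewrite !(mevalC, mevalB, mevalZ, mevalD, mevalM, exprS, expr0).
  rewrite !mevalXU !lin0.
  by rewrite !(mul0r, mulr0, addr0, oppr0, add0r) => <-; rewrite mpolyC0 addr0.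
have tlin (i : 'I_3) : exists d, t`_i = linear_form d.
  by case: (ord3 i) => ->; [exists a | exists b | exists c].
have Hj : \det (hessian C) \mPo t = j *: \det (hessian C).
  have /(congr1 determinant) := hessian_comp_linear C tlin.
  have -> : hessian (C \mPo t) = j%:MP *: hessian C.
    by apply/matrixP => i k; rewrite !mxE Ct !mderivZ mul_mpolyC.
  rewrite detZ !det_mulmx det_tr -/(jacobian f g h) Jj det_map_mx => e.
  have j2 : (j%:MP : P) ^+ 2 != 0 by rewrite expf_neq0 ?mpolyC_eq0.
  apply: (mulfI j2); rewrite -mul_mpolyC mulrA -exprSr e; ring.
have n0 : 8%:R * (1 - alpha ^+ 3) != 0.
  by rewrite mulf_neq0 ?K_natr_neq0 // subr_eq0 eq_sym.
move: Hj; rewrite det_hessian_C // rmorphB /= !comp_mpolyZ Ct.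
move: (elliptic_C alpha) => D; rewrite [j *: (_ - _)]scalerBr !scalerA.
rewrite [_ * j]mulrC => /addIr.
rewrite [j * _]mulrC -(scalerA _ j) => /(scalerI n0) <-.
by rewrite !rmorphM /= !comp_mpolyXU.
Qed.

(** Restriction to the plane X_i = 0. *)
Lemma linear_form_kill i a :
  linear_form a \mPo [tuple if k == i then 0 else 'X_k | k < 3] =
  linear_form (fun k => if k == i then 0 else a k).
Proof.
rewrite raddf_sum; apply: eq_bigr => k _ /=.
rewrite comp_mpolyZ comp_mpolyXU -tnth_nth tnth_mktuple.
by case: eqP; rewrite ?scale0r ?scaler0.
Qed.

(** The product vanishes on the plane X_i = 0, so one of the factors does. *)
Lemma prod_linear_forms a b c (j : K) i :
  linear_form a * linear_form b * linear_form c = j *: (x * y * z) ->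
  [\/ forall k, k != i -> a k = 0, forall k, k != i -> b k = 0
    | forall k, k != i -> c k = 0].
Proof.
have kill d : linear_form (fun k => if k == i then 0 else d k) = 0 ->
    forall k, k != i -> d k = 0 :> K.
  by move=> d0 k /negPf ki; have := linear_form_eq0 d0 k; rewrite ki.
move/(congr1 (comp_mpoly [tuple if k == i then 0 else 'X_k | k < 3])).
rewrite comp_mpolyZ !rmorphM /= !linear_form_kill => e.
have /eqP : linear_form (fun k => if k == i then 0 else a k) *
  linear_form (fun k => if k == i then 0 else b k) *
  linear_form (fun k => if k == i then 0 else c k) = 0.
  rewrite e !comp_mpolyXU -!tnth_nth !tnth_mktuple.
  by case: (ord3 i) => -> /=; rewrite ?(mul0r, mulr0) scaler0.
rewrite !mulf_eq0 -orbA => /or3P[] /eqP /kill H;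
  by [constructor 1 | constructor 2 | constructor 3].
Qed.

Lemma linear_form1 a i :
  (forall k, k != i -> a k = 0) -> linear_form a = a i *: 'X_i.
Proof.
move=> a0; rewrite /linear_form (bigD1 i) //= big1 ?addr0 // => k ki.
by rewrite a0 // scale0r.
Qed.

(** Each variable is, up to a scalar, one of f, g, h.  No form corresponds to
    two variables, as it would be zero; six orders remain.  In the three even ones
    the relations read p^2 = q r, q^2 = r p, r^2 = p q; in the odd ones they
    acquire a minus sign, and multiplying them gives 2 (p q r)^2 = 0. *)
Lemma triple_monomial a b c (j : K) :
  let f := linear_form a in let g := linear_form b in let h := linear_form c in
  triple f g h -> jacobian f g h = j%:MP -> j != 0 ->
  exists i : 'I_3, exists p q r : K,
  [/\ [/\ f = p *: 'X_i, g = q *: 'X_(i + 1) & h = r *: 'X_(i + 2)],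
      [/\ p != 0, q != 0 & r != 0]
    & [/\ p ^+ 2 = q * r, q ^+ 2 = r * p & r ^+ 2 = p * q]].
Proof.
move=> f g h fgh Jj j0; have prod := triple_prod fgh Jj j0.
have prod0 : f * g * h != 0.
  have X0 i : 'X_i != 0 :> P.
    apply/eqP => /(congr1 (meval (fun=> 1))); rewrite mevalXU meval0 => /eqP.
    by rewrite oner_eq0.
  by rewrite prod scaler_eq0 negb_or j0 !mulf_neq0.
have nz d : linear_form d != 0 -> d 0 = 0 -> d 1 = 0 -> d 2 = 0 -> False.
  move=> /eqP d0 e0 e1 e2; apply: d0.
  by rewrite /linear_form sum_ord3 e0 e1 e2 !scale0r !addr0.
move: prod0; rewrite !mulf_eq0 !negb_or => /andP[/andP[/nz na /nz nb] /nz nc].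
have odd p q r :
    - (q * r) = p ^+ 2 -> - (r * p) = q ^+ 2 -> - (p * q) = r ^+ 2 ->
    p = 0 \/ q = 0 \/ r = 0 :> K.
  move=> ep eq er; have /eqP : 2%:R * (p * q * r) ^+ 2 = 0.
    transitivity ((p * q * r) ^+ 2 + p ^+ 2 * q ^+ 2 * r ^+ 2); first by ring.
    by rewrite -ep -eq -er; ring.
  rewrite mulf_eq0 (negPf (K_natr_neq0 K0 1)) expf_eq0 /= !mulf_eq0.
  by case/orP=> [/orP[]|] /eqP; auto.
case: fgh => /br_linear_forms - /(_ K0) [fg0 fg1 fg2].
move=> /br_linear_forms - /(_ K0) [gh0 gh1 gh2].
move=> /br_linear_forms - /(_ K0) [hf0 hf1 hf2].
have v0 : (a 1 = 0 /\ a 2 = 0) \/ (b 1 = 0 /\ b 2 = 0) \/ (c 1 = 0 /\ c 2 = 0).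
  by case: (prod_linear_forms 0 prod) => H;
    [left | right; left | right; right]; rewrite !H.
have v1 : (a 0 = 0 /\ a 2 = 0) \/ (b 0 = 0 /\ b 2 = 0) \/ (c 0 = 0 /\ c 2 = 0).
  by case: (prod_linear_forms 1 prod) => H;
    [left | right; left | right; right]; rewrite !H.
have v2 : (a 0 = 0 /\ a 1 = 0) \/ (b 0 = 0 /\ b 1 = 0) \/ (c 0 = 0 /\ c 1 = 0).
  by case: (prod_linear_forms 2 prod) => H;
    [left | right; left | right; right]; rewrite !H.
(* Of the 27 ways to assign a form to each variable, the six bijections
   survive. *)
case: v0 => [[z01 z02]|[[z01 z02]|[z01 z02]]];
case: v1 => [[z10 z12]|[[z10 z12]|[z10 z12]]];
case: v2 => [[z20 z21]|[[z20 z21]|[z20 z21]]];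
  try (by case: na); try (by case: nb); try (by case: nc).
all: rewrite !(z01, z02, z10, z12, z20, z21, mul0r, mulr0, subr0, sub0r,
  expr0n, oppr0, addr0) /= in fg0 fg1 fg2 gh0 gh1 gh2 hf0 hf1 hf2.
- exists 0, (a 0), (b 1), (c 2); rewrite add0r; split; last by [].
    by split; apply: linear_form1 => k; case: (ord3 k) => ->.
  by split; apply/eqP => e; [apply: na | apply: nb | apply: nc].
- by case: (odd _ _ _ gh0 hf2 fg1) => [|[]] e; [case: na | case: nb | case: nc].
- by case: (odd _ _ _ gh1 hf0 fg2) => [|[]] e; [case: na | case: nb | case: nc].
- have [s1 s2] : 2 + 1 = 0 :> 'I_3 /\ 2 + 2 = 1 :> 'I_3.
    by split; apply: val_inj.
  exists 2, (a 2), (b 0), (c 1); rewrite s1 s2; split; last by [].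
    by split; apply: linear_form1 => k; case: (ord3 k) => ->.
  by split; apply/eqP => e; [apply: na | apply: nb | apply: nc].
- have [s1 s2] : 1 + 1 = 2 :> 'I_3 /\ 1 + 2 = 0 :> 'I_3.
    by split; apply: val_inj.
  exists 1, (a 1), (b 2), (c 0); rewrite s1 s2; split; last by [].
    by split; apply: linear_form1 => k; case: (ord3 k) => ->.
  by split; apply/eqP => e; [apply: na | apply: nb | apply: nc].
- by case: (odd _ _ _ gh2 hf1 fg0) => [|[]] e; [case: na | case: nb | case: nc].
Qed.

End MonomialTriples.

(** * Normal form of a Poisson automorphism *)

Section Automorphisms.
Variables (K : fieldType) (alpha : K).
Hypothesis K0 : [pchar K] =i pred0.
Local Notation P := {mpoly K[3]}.
Local Notation x := ('X_0 : P).
Local Notation y := ('X_1 : P).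
Local Notation z := ('X_2 : P).
Local Notation aut := (poisson_aut (elliptic_br alpha)).
Implicit Types phi psi : aut.

Lemma paut1 phi : phi 1 = 1.
Proof.
case: phi => f /= [[g fK gK] _ fM _].
by rewrite -[RHS]gK -[g 1]mul1r fM gK mulr1.
Qed.

Lemma pautP_lin phi k p q : phi (k *: p + q) = k *: phi p + phi q.
Proof. by case: phi => f /= [_ fL _ _]; rewrite fL. Qed.

Lemma pautM phi p q : phi (p * q) = phi p * phi q.
Proof. by case: phi => f /= [_ _ fM _]; rewrite fM. Qed.

Lemma paut_br phi p q :
  phi (elliptic_br alpha p q) = elliptic_br alpha (phi p) (phi q).
Proof. by case: phi => f /= [_ _ _ fB]; rewrite fB. Qed.

Lemma pautZ phi k p : phi (k *: p) = k *: phi p.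
Proof.
have phi0 : phi 0 = 0.
  by have := pautP_lin phi (-1) 0 0; rewrite scaler0 addr0 scaleN1r addNr.
by have := pautP_lin phi k p 0; rewrite phi0 !addr0.
Qed.

Lemma pautD phi p q : phi (p + q) = phi p + phi q.
Proof. by have := pautP_lin phi 1 p q; rewrite !scale1r. Qed.

Definition paut_tuple phi : 3.-tuple P := [tuple phi x; phi y; phi z].

Lemma paut_compE phi p : phi p = p \mPo paut_tuple phi.
Proof.
elim/mpoly_alg_ind: p => [|i|k p q Ep Eq|p q Ep Eq].
- by rewrite paut1 comp_mpoly1.
- by rewrite comp_mpolyXU; case: (ord3 i) => ->.
- by rewrite pautP_lin Ep Eq comp_mpolyD comp_mpolyZ.
- by rewrite pautM Ep Eq rmorphM.
Qed.

Lemma paut_extX phi psi : (forall i, phi 'X_i = psi 'X_i) -> phi = psi.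
Proof.
move=> e; apply: paut_ext => p; rewrite !paut_compE /paut_tuple.
by rewrite !e.
Qed.

Lemma paut_triple phi : elliptic_triple alpha (phi x) (phi y) (phi z).
Proof.
have [exy eyz ezx] := elliptic_br_pchar0 alpha K0.
have br i k l :
    elliptic_br alpha 'X_i 'X_k = - (alpha *: ('X_i * 'X_k)) + 'X_l ^+ 2 ->
    elliptic_br alpha (phi 'X_i) (phi 'X_k) =
      phi 'X_l ^+ 2 - alpha *: (phi 'X_i * phi 'X_k).
  move=> e; rewrite -paut_br e addrC pautD -scaleNr pautZ scaleNr expr2.
  by rewrite !pautM -expr2.
by split; apply: br.
Qed.

(** The Jacobian is invertible, by the chain rule applied to the automorphism
    and its inverse, and the units of the polynomial ring are constants. *)
Lemma paut_jacobian phi :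
  exists2 j : K, jacobian (phi x) (phi y) (phi z) = j%:MP & j != 0.
Proof.
have [_ invK] := paut_invK phi; set psi := paut_inv phi in invK.
have : (jacobian (psi x) (psi y) (psi z) \mPo paut_tuple phi)
    * jacobian (phi x) (phi y) (phi z) = 1.
  rewrite -(@jacobian_comp _ _ _ _ (paut_tuple phi)) -!paut_compE !invK.
  by rewrite jacobianE !mderivU /=; ring.
by case/mpoly_mulI => ej j0; exists (jacobian (phi x) (phi y) (phi z))@_0.
Qed.

Section NormalForm.
Variables (eps : K) (eps_root : eps ^+ 2 + eps + 1 = 0).

Lemma eps_expr_mod n : eps ^+ (n %% 3) = eps ^+ n.
Proof.
by rewrite [in RHS](divn_eq n 3) exprD mulnC exprM eps_cube // expr1n mul1r.
Qed.

Lemma cube_root1 (w : K) : w ^+ 3 = 1 -> exists j : 'I_3, w = eps ^+ j.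
Proof.
move=> w3; have : (w - 1) * (w - eps) * (w - eps ^+ 2) = 0.
  transitivity (w ^+ 3 - w ^+ 2 * (eps ^+ 2 + eps + 1)
    + w * eps * (eps ^+ 2 + eps + 1) - eps ^+ 3); first by ring.
  by rewrite eps_root w3 eps_cube // !mulr0 subr0 addr0 subrr.
move=> /eqP; rewrite !mulf_eq0 !subr_eq0 -orbA => /or3P[]/eqP->.
- by exists 0.
- by exists 1.
- by exists 2.
Qed.

Hypothesis alpha3 : alpha ^+ 3 != 1.

(** From p^2 = q r and q^2 = r p follows q^3 = p^3, so q = p w with w a power
    of eps, and then r = p w^2. *)
Lemma paut_normal_form phi : exists (g : kstar K) (i j : 'I_3),
  forall k, phi 'X_k = (val g * eps ^+ (j * k)%N) *: 'X_(i + k).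
Proof.
have [d Jd d0] := paut_jacobian phi; have fgh := paut_triple phi.
have [sf sg sh] := elliptic_triple_deg1 K0 alpha3 fgh Jd.
have [a ea] := triple_linear K0 alpha3 fgh sf.
have [b eb] := triple_linear K0 alpha3 (elliptic_triple_rot fgh) sg.
have hfg := elliptic_triple_rot (elliptic_triple_rot fgh).
have [c ec] := triple_linear K0 alpha3 hfg sh.
rewrite ea eb ec in Jd fgh.
have [i [p [q [r [[fa gb hc] [p0 q0 r0] [ep eq er]]]]]] :=
  triple_monomial K0 alpha3 fgh Jd d0.
rewrite fa in ea; rewrite gb in eb; rewrite hc in ec.
have q3 : (q / p) ^+ 3 = 1.
  rewrite expr_div_n; apply: (canLR (mulfK _)); first by rewrite expf_neq0.
  by rewrite mul1r exprS eq exprS ep; ring.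
have [j ej] := cube_root1 q3; exists (exist _ p p0), i, j => k /=.
have eqp : q = p * eps ^+ j by rewrite -ej mulrC divfK.
have erp : r = p * eps ^+ (j * 2).
  apply: (mulfI p0); rewrite [p * r]mulrC -eq eqp exprM; ring.
case: (ord3 k) => ->; rewrite ?muln0 ?muln1 ?expr0 ?mulr1 ?addr0.
- exact: ea.
- by rewrite -eqp.
- by rewrite -erp.
Qed.

End NormalForm.
End Automorphisms.

(** * The automorphism group *)

Section GroupStructure.
Variables (K : fieldType) (eps alpha : K) (eps_root : eps ^+ 2 + eps + 1 = 0).
Hypotheses (K0 : [pchar K] =i pred0) (alpha3 : alpha ^+ 3 != 1).
Local Notation P := {mpoly K[3]}.
Local Notation G := (poisson_aut (elliptic_br alpha)).
Local Notation H := (external_sdprod (twist_act eps_root)).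
Local Notation sg := (sigma alpha eps_root).
Local Notation ta := (tau alpha).

Lemma phiX (g : kstar K) k : phi alpha g 'X_k = val g *: 'X_k.
Proof. by rewrite /= comp_mpolyXU; case: (ord3 k) => ->. Qed.

Lemma tauXn n (k : 'I_3) : (ta ^+ n)%g 'X_k = 'X_(n%:R + k).
Proof.
elim: n k => [|n IHn] k; first by rewrite add0r.
rewrite expgS -[LHS]/(ta ((ta ^+ n)%g 'X_k)) IHn -natr1 addrAC /= comp_mpolyXU.
by case: (ord3 (n%:R + k)) => -> //=; congr (mpolyX _ (mnm1 _)); apply: val_inj.
Qed.

Lemma sigmaXn n (k : 'I_3) : (sg ^+ n)%g 'X_k = eps ^+ (n * k)%N *: 'X_k.
Proof.
elim: n => [|n IHn]; first by rewrite mul0n expr0 scale1r.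
rewrite expgS -[LHS]/(sg ((sg ^+ n)%g 'X_k)) IHn pautZ mulSn exprD mulrC.
rewrite -scalerA.
congr (_ *: _); rewrite /= comp_mpolyXU.
by case: (ord3 k) => -> //=; rewrite expr0 scale1r.
Qed.

Definition aut_of (u : H) : G := (phi alpha u.1.1 * ta ^+ u.1.2 * sg ^+ u.2)%g.

Lemma aut_ofX (u : H) (k : 'I_3) :
  aut_of u 'X_k = (val u.1.1 * eps ^+ (u.2 * k)%N) *: 'X_((u.1.2 : 'I_3) + k).
Proof.
rewrite -[LHS]/(phi alpha u.1.1 ((ta ^+ u.1.2)%g ((sg ^+ u.2)%g 'X_k))).
by rewrite sigmaXn !pautZ tauXn phiX scalerA mulrC natr_Zp.
Qed.

Lemma val_eps_kstarX n : val (eps_kstar eps_root ^+ n)%g = eps ^+ n.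
Proof. by elim: n => [|n IHn] //; rewrite expgS exprS -IHn. Qed.

(** Moving sigma^j past tau^m costs the scalar eps^(m j), which is the action
    that twist_act builds into the model group. *)
Lemma aut_ofM (u v : H) : aut_of (u * v)%g = (aut_of u * aut_of v)%g.
Proof.
apply: paut_extX => k; rewrite -[RHS]/(aut_of u (aut_of v 'X_k)).
rewrite !aut_ofX pautZ aut_ofX.
case: u v => [[g i] j] [[d m] l]; rewrite scalerA /=.
have -> : ((i * m)%g : 'I_3) + k = (i : 'I_3) + ((m : 'I_3) + k).
  by rewrite addrA.
congr (_ *: _).
rewrite -[LHS]/(val g * (val (eps_kstar eps_root ^+ (m * j)%N)%g * val d)
  * eps ^+ ((j * l)%g * k)%N).
rewrite -[RHS]/(val d * eps ^+ (l * k)%N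
  * (val g * eps ^+ (j * (((m : 'I_3) + k)%R : 'I_3))%N)).
rewrite val_eps_kstarX.
have -> : eps ^+ ((j * l)%g * k)%N = eps ^+ (j * k)%N * eps ^+ (l * k)%N.
  rewrite -(eps_expr_mod eps_root) /= modnMml (eps_expr_mod eps_root).
  by rewrite mulnDl exprD.
have -> : eps ^+ (j * (((m : 'I_3) + k)%R : 'I_3))%N =
    eps ^+ (m * j)%N * eps ^+ (j * k)%N.
  rewrite -(eps_expr_mod eps_root) /= modnMmr (eps_expr_mod eps_root).
  by rewrite mulnDr exprD [(m * j)%N]mulnC.
ring.
Qed.

Lemma external_sdprodM (a b : kstar K) (i k j l : 'Z_3) :
  ((((a, i), j) : H) * (((b, k), l) : H) =
  (((a * (eps_kstar eps_root ^+ (k * j)%N * b), i * k), j * l) : H))%g.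
Proof. by []. Qed.

Lemma aut_of_surj (f : G) : exists u, aut_of u = f.
Proof.
have [g [i [j e]]] := paut_normal_form K0 eps_root alpha3 f.
by exists ((g, i), j); apply: paut_extX => k; rewrite e aut_ofX.
Qed.

Lemma eq_monomial (c d : K) (i k : 'I_3) : c != 0 ->
  c *: 'X_i = d *: 'X_k :> P -> c = d /\ i = k.
Proof.
move=> c0 /(congr1 (mderiv i)); rewrite !mderivZ !mderivU eqxx.
case: eqP => [-> |_]; last first.
  by rewrite scaler0 -mul_mpolyC mulr1 => /eqP; rewrite mpolyC_eq0 (negPf c0).
rewrite -!mul_mpolyC !mulr1 => /eqP.
by rewrite -subr_eq0 -mpolyCB mpolyC_eq0 subr_eq0 => /eqP.
Qed.

Lemma eps_exp_inj (i j : 'I_3) : eps ^+ i = eps ^+ j -> i = j.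
Proof.
have e1 : eps != 1.
  apply/eqP => e; move/eqP: eps_root; rewrite e expr1n.
  by rewrite -(natrD _ 1 1) -(natrD _ 2 1) (negPf (K_natr_neq0 K0 2)).
have e0 : eps != 0 := eps_neq0 eps_root.
have e2 : eps ^+ 2 != 1.
  apply: contra e1 => /eqP e; rewrite -(eps_cube eps_root) exprS e mulr1 //.
have e12 : eps != eps ^+ 2.
  by rewrite expr2 -[X in X != _]mulr1 (inj_eq (mulfI e0)) eq_sym.
move=> /eqP; case: (ord3 i) => ->; case: (ord3 j) => -> //=;
  rewrite ?expr0 ?expr1 1?eq_sym ?(negPf e1) ?(negPf e2) ?(negPf e12) //.
all: rewrite 1?eq_sym ?(negPf e1) ?(negPf e2) ?(negPf e12) //.
Qed.

(** The image of x determines gamma and i, and then the image of y gives j. *)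
Lemma aut_of_inj : injective aut_of.
Proof.
move=> [[g i] j] [[d m] l] e.
have nz (h : kstar K) n : val h * eps ^+ n != 0.
  by rewrite mulf_neq0 ?(valP h) // expf_neq0 // (eps_neq0 eps_root).
have E (k : 'I_3) : val g * eps ^+ (j * k)%N = val d * eps ^+ (l * k)%N /\
    (i : 'I_3) + k = (m : 'I_3) + k.
  apply: eq_monomial => //.
  by have := congr1 (fun f : G => f 'X_k) e; rewrite !aut_ofX.
have [+ im] := E 0; rewrite !muln0 !mulr1 => /val_inj gd.
have [+ _] := E 1; rewrite !muln1 gd => /(mulfI (valP d)) /eps_exp_inj jl.
by move/addIr: im => im; rewrite im jl.
Qed.

Lemma aut_of_iso :
  exists2 f : G -> H,
    {morph f : u v / (u * v)%g} & cancel aut_of f /\ cancel f aut_of.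
Proof.
pose f (a : G) := projT1 (cid (aut_of_surj a)).
have fK : cancel f aut_of by move=> a; apply: projT2 (cid (aut_of_surj a)).
exists f; last by split=> // u; apply: aut_of_inj; rewrite fK.
by move=> a b; apply: aut_of_inj; rewrite aut_ofM !fK.
Qed.

End GroupStructure.

(** * Kernels and cyclic subgroups *)

Section SubgroupTools.
Variables (G H : groupType) (f : G -> H).
Hypothesis fM : {morph f : u v / (u * v)%g}.
Local Open Scope group_scope.

Lemma morph1g : f 1 = 1.
Proof. by apply: (mulgI (f 1)); rewrite -fM !mulg1. Qed.

Lemma morphVg u : f u^-1 = (f u)^-1.
Proof. by apply: (mulgI (f u)); rewrite -fM !mulgV morph1g. Qed.

Lemma ker_subgroup : subgroup_set [set u | f u = 1].
Proof.
split=> [|u v /= fu fv]; first exact: morph1g.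
by rewrite fM morphVg fu fv invg1 mulg1.
Qed.

Lemma ker_normal u v : f u = 1 -> f (u ^ v) = 1.
Proof. by move=> fu; rewrite conjgE !fM morphVg fu mul1g mulVg. Qed.

Lemma gen_subgroup_subgroup (A : set G) : subgroup_set (gen_subgroup A).
Proof.
split=> [S [[S1 _] _] //|u v Au Av S sS].
by have [[_ SV] _] := sS; apply: SV; [apply: Au | apply: Av].
Qed.

Lemma gen_subgroup1 n (t : G) : t ^+ n.+1 = 1 ->
  gen_subgroup [set t] = range (fun i : 'I_n.+1 => t ^+ i).
Proof.
move=> tn; have tX k : t ^+ (k %% n.+1) = t ^+ k.
  by rewrite {2}(divn_eq k n.+1) expgnDr mulnC expgnA tn expg1n mul1g.
apply/seteqP; split=> [u|_ [i _ <-]].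
  apply; split=> [|_ ->]; last first.
    by exists (inord (1 %% n.+1)) => //; rewrite inordK ?ltn_mod // tX.
  split=> [|_ _ [i _ <-] [j _ <-]]; first by exists ord0.
  exists (inord ((i + (n.+1 - j)) %% n.+1)) => //.
  rewrite inordK ?ltn_mod // tX expgnDr; congr (_ * _).
  by apply: (mulIg (t ^+ j)); rewrite mulVg -expgnDr subnK ?tn // ltnW.
have [g1 gV] := gen_subgroup_subgroup [set t].
have tg : gen_subgroup [set t] t by move=> S [_ St]; apply: St.
elim: (i : nat) => [|k IHk]; first by rewrite expg0.
have V : gen_subgroup [set t] (t ^+ k)^-1.
  by rewrite -[_^-1]mul1g; apply: (gV _ _ g1 IHk).
by have := gV _ _ tg V; rewrite invgK -expgS.
Qed.

End SubgroupTools.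

(** * The decomposition *)

Theorem theorem2 (K : fieldType) (K_pchar0 : [pchar K] =i pred0)
    (eps : K) (eps_root : eps ^+ 2 + eps + 1 = 0)
    (alpha : K) (alpha_cube : alpha ^+ 3 <> 1) :
  [/\ exists2 M : set (poisson_aut (elliptic_br alpha)),
        internal_dprod (range (phi alpha)) (gen_subgroup [set tau alpha]) M &
        internal_sdprod M (gen_subgroup [set sigma alpha eps_root]) setT,
      exists2 M : set (poisson_aut (elliptic_br alpha)),
        internal_dprod (range (phi alpha))
                       (gen_subgroup [set sigma alpha eps_root]) M &
        internal_sdprod M (gen_subgroup [set tau alpha]) setT &
      group_isomorphic (poisson_aut (elliptic_br alpha))
                 (external_sdprod (twist_act eps_root))].
Proof.
have alpha3 : alpha ^+ 3 != 1 by apply/eqP.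
have [f fM [aK fK]] := aut_of_iso eps_root K_pchar0 alpha3.
have f_inj : injective f by exact: can_inj fK.
(* Unlike gamma, the exponents of tau and of sigma are homomorphisms to Z/3;
   their kernels are the normal factors of the semidirect products. *)
pose c2 u : 'Z_3 := (f u).1.2; pose c3 u : 'Z_3 := (f u).2.
have c2M : {morph c2 : u v / (u * v)%g} by move=> u v; rewrite /c2 fM.
have c3M : {morph c3 : u v / (u * v)%g} by move=> u v; rewrite /c3 fM.
have f_phi g : f (phi alpha g) = ((g, 1%g), 1%g).
  by rewrite -[RHS]aK /aut_of /= !expg0 !mulg1.
have phi1 : phi alpha 1%g = 1%g by apply: f_inj; rewrite f_phi (morph1g fM).
have f_tau (i : 'Z_3) : f (tau alpha ^+ i)%g = ((1%g, i), 1%g).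
  by rewrite -[RHS]aK /aut_of /= phi1 expg0 mulg1 mul1g.
have f_sigma (j : 'Z_3) : f (sigma alpha eps_root ^+ j)%g = ((1%g, 1%g), j).
  by rewrite -[RHS]aK /aut_of /= phi1 expg0 !mul1g.
have tau3 : (tau alpha ^+ 3 = 1)%g.
  have z3 : 3%:R = 0 :> 'I_3 by apply: val_inj.
  by apply: paut_extX => k; rewrite tauXn z3 add0r.
have sigma3 : (sigma alpha eps_root ^+ 3 = 1)%g.
  by apply: paut_extX => k; rewrite sigmaXn exprM eps_cube // expr1n scale1r.
have decomp u : u = (phi alpha (f u).1.1 * tau alpha ^+ c2 u
                      * sigma alpha eps_root ^+ c3 u)%g by rewrite -[LHS]fK.
have rphi : range (phi alpha) = [set u | c2 u = 1%g] `&` [set u | c3 u = 1%g].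
  apply/seteqP; split=> [_ [g _ <-]|u [/= u2 u3]].
    by rewrite /= /c2 /c3 f_phi.
  by exists (f u).1.1 => //; rewrite [RHS]decomp u2 u3 !expg0 !mulg1.
have subphi : subgroup_set (range (phi alpha)).
  rewrite rphi; have [a1 aV] := ker_subgroup c2M.
  have [b1 bV] := ker_subgroup c3M.
  by split=> // u v [u2 u3] [v2 v3]; split; [apply: aV | apply: bV].
have subgen t :=
  @gen_subgroup_subgroup (poisson_aut (elliptic_br alpha)) [set t].
have gtau := gen_subgroup1 tau3; have gsigma := gen_subgroup1 sigma3.
split.
- exists [set u | c3 u = 1%g].
    split=> //.
    + rewrite gtau => _ _ [g _ <-] [i _ <-]; apply: f_inj.
      rewrite !fM f_phi f_tau !external_sdprodM /=.
      by rewrite !muln0 !expg0 !mul1g !mulg1.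
    + rewrite gtau; apply/seteqP; split=> [w [[g _ <-] [i _ e]]|_ ->].
        have := congr1 (fun v => (f v).1.1) e; rewrite f_phi f_tau /= => <-.
        exact: phi1.
      by split; [exists 1%g | exists ord0].
    + rewrite gtau; apply/seteqP.
      split=> [w [v [g _ <-] [t [i _ <-] <-]]|u /= u3].
        by rewrite /= c3M /c3 f_phi f_tau mulg1.
      exists (phi alpha (f u).1.1); first by exists (f u).1.1.
      exists (tau alpha ^+ c2 u)%g; first by exists (c2 u).
      by rewrite [RHS]decomp u3 expg0 mulg1.
  split=> //; first exact: ker_subgroup.
  + by move=> u v u3 _; apply: ker_normal.
  + rewrite gsigma; apply/seteqP; split=> [w [w1 [j _ e]]|_ ->].
      by move: w1; rewrite -e /= /c3 f_sigma /= => ->; rewrite expg0.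
    by split; [apply: (morph1g c3M) | exists ord0].
  + rewrite gsigma; apply/seteqP; split=> // u _.
    exists (phi alpha (f u).1.1 * tau alpha ^+ c2 u)%g.
      by rewrite /= c3M /c3 f_phi f_tau mulg1.
    exists (sigma alpha eps_root ^+ c3 u)%g; first by exists (c3 u).
    exact/esym/decomp.
- exists [set u | c2 u = 1%g].
    split=> //.
    + rewrite gsigma => _ _ [g _ <-] [j _ <-]; apply: f_inj.
      rewrite !fM f_phi f_sigma !external_sdprodM /=.
      by rewrite !mul0n !expg0 !mul1g !mulg1.
    + rewrite gsigma; apply/seteqP; split=> [w [[g _ <-] [j _ e]]|_ ->].
        have := congr1 (fun v => (f v).1.1) e; rewrite f_phi f_sigma /= => <-.
        exact: phi1.
      by split; [exists 1%g | exists ord0].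
    + rewrite gsigma; apply/seteqP.
      split=> [w [v [g _ <-] [t [j _ <-] <-]]|u /= u2].
        by rewrite /= c2M /c2 f_phi f_sigma mulg1.
      exists (phi alpha (f u).1.1); first by exists (f u).1.1.
      exists (sigma alpha eps_root ^+ c3 u)%g; first by exists (c3 u).
      by rewrite [RHS]decomp u2 expg0 mulg1.
  split=> //; first exact: ker_subgroup.
  + by move=> u v u2 _; apply: ker_normal.
  + rewrite gtau; apply/seteqP; split=> [w [w1 [i _ e]]|_ ->].
      by move: w1; rewrite -e /= /c2 f_tau /= => ->; rewrite expg0.
    by split; [apply: (morph1g c2M) | exists ord0].
  + rewrite gtau; apply/seteqP; split=> // u _.
    exists (u * (tau alpha ^+ c2 u)^-1)%g.
      by rewrite /= c2M (morphVg c2M) {2}/c2 f_tau mulgV.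
    exists (tau alpha ^+ c2 u)%g; first by exists (c2 u).
    by rewrite -mulgA mulVg mulg1.
- pose fm := isMultiplicative.Build _ _ f fM.
  exists (HB.pack_for {multiplicative _ -> _} f fm).
  by exists (@aut_of _ eps alpha eps_root).
Qed.
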